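(* Let $f:\mathbb{R}^d\to\mathbb{R}$ be Lipschitz continuous with constant $L_0>0$ and bounded below by $f^\ast$. Let $\epsilon_f>0$ and let $T>1/\epsilon_f$ be an integer. Run the zeroth-order iteration $x_{t+1}=x_t-\eta\,\tilde g(x_t)$ with one-point residual feedback (defined in the context) for $T$ iterations with $\eta=\frac{\sqrt{\epsilon_f}}{2dL_0^2\sqrt{T}}$ and $\delta=\frac{\epsilon_f}{L_0 d^{1/2}}$, and let $\tilde x$ be selected uniformly at random from the $T$ iterates $x_0,\dots,x_{T-1}$ (independently of everything else). Then $$\mathbb{E}\big[\|\nabla f_\delta(\tilde x)\|^2\big]=\mathcal{O}\big(d^2\,\epsilon_f^{-0.5}\,T^{-0.5}\big).$$
   Context: Deterministic residual feedback: $x_0\in\mathbb{R}^d$ is a given deterministic point, $u_0,u_1,u_2,\dots$ are i.i.d. standard Gaussian vectors in $\mathbb{R}^d$, $\delta>0$ is the exploration parameter and $\eta>0$ the stepsize. For $t\ge 1$, $$\tilde g(x_t)=\frac{u_t}{\delta}\big(f(x_t+\delta u_t)-f(x_{t-1}+\delta u_{t-1})\big),$$ and at $t=0$, $\tilde g(x_0)=\frac{u_0}{\delta}f(x_0+\delta u_0)$. The iterates are $x_{t+1}=x_t-\eta\,\tilde g(x_t)$. Smoothed function: $f_\delta(x):=\mathbb{E}_{u}[f(x+\delta u)]$, with $u$ a standard Gaussian vector in $\mathbb{R}^d$ (it is differentiable). Meaning of $\mathcal{O}$: the left side is at most $C\,d^2\epsilon_f^{-0.5}T^{-0.5}$, where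 $C$ depends only on $L_0$, the initial gap $f_\delta(x_0)-\inf f_\delta$, and $\mathbb{E}[\|\tilde g(x_0)\|^2]$ (and on nothing else; no further dependence on $d,T,\epsilon_f$). *)

(* Defs.v *)
From HB Require Import structures.
From mathcomp Require Import all_boot all_order all_algebra.
From mathcomp Require Import finmap.
From mathcomp Require Import all_classical all_reals all_analysis.

Set Implicit Arguments.
Unset Strict Implicit.
Unset Printing Implicit Defensive.

Import Order.TTheory GRing.Theory Num.Theory.
Import numFieldNormedType.Exports.

Local Open Scope classical_set_scope.
Local Open Scope ring_scope.

(* The library norm `|v| on row vectors is the sup norm, hence this one. *)
Definition enorm (R : realType) (d : nat) (v : 'rV[R]_d) : R :=
  Num.sqrt (\sum_(i < d) v ord0 i ^+ 2).

Definition grad (R : realType) (d : nat) (g : 'rV[R]_d -> R) (x : 'rV[R]_d) :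
    'rV[R]_d :=
  \row_(i < d) 'D_(delta_mx ord0 i) g x.

Definition mutually_independent (R : realType) (dO : measure_display)
    (Omega : measurableType dO) (P : probability Omega R) (I : choiceType)
    (F : I -> set (set Omega)) : Prop :=
  forall (J : {fset I}) (A : I -> set Omega),
    (forall i, i \in J -> F i (A i)) ->
    P (\bigcap_(i in [set` J]) A i) = (\prod_(i <- J) P (A i))%E.

Definition independent (R : realType) (dO : measure_display)
    (Omega : measurableType dO) (P : probability Omega R)
    (F G : set (set Omega)) : Prop :=
  forall A B, F A -> G B -> P (A `&` B) = (P A * P B)%E.

Definition coordinate (R : realType) (Omega : Type) (d : nat)
    (U : Omega -> 'rV[R]_d) (i : 'I_d) : Omega -> R :=
  fun w => U w ord0 i.

(* The sigma-algebra generated by the coordinates of U is the family of the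
   preimages under U of the Borel sets of R^d. *)
Definition sigma_vector (R : realType) (Omega : Type) (d : nat)
    (U : Omega -> 'rV[R]_d) : set (set Omega) :=
  g_sigma_preimage (coordinate U).

Definition sigma_process (R : realType) (Omega : Type) (d : nat)
    (u : nat -> Omega -> 'rV[R]_d) : set (set Omega) :=
  <<s \bigcup_t sigma_vector (u t) >>.

Definition standard_gaussian (R : realType) (dO : measure_display)
    (Omega : measurableType dO) (P : probability Omega R) (d : nat)
    (U : Omega -> 'rV[R]_d) : Prop :=
  [/\ forall i, measurable_fun setT (coordinate U i),
      forall i (B : set R), measurable B ->
        P (coordinate U i @^-1` B) = normal_prob 0 1 B
    & mutually_independent P
        (fun i => g_sigma_algebra_preimage (coordinate U i))].

Definition iid_standard_gaussian (R : realType) (dO : measure_display)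
    (Omega : measurableType dO) (P : probability Omega R) (d : nat)
    (u : nat -> Omega -> 'rV[R]_d) : Prop :=
  (forall t, standard_gaussian P (u t)) /\
  mutually_independent P (fun t => sigma_vector (u t)).

Definition smoothed (R : realType) (dO : measure_display)
    (Omega : measurableType dO) (P : probability Omega R) (d : nat)
    (U : Omega -> 'rV[R]_d) (f : 'rV[R]_d -> R) (delta : R) (x : 'rV[R]_d) : R :=
  fine ('E_P[(fun w => f (x + delta *: U w))%R])%E.

(* u and x are the realised sequences of perturbations and iterates. *)
Definition residual_feedback (R : realType) (d : nat) (f : 'rV[R]_d -> R)
    (delta : R) (u x : nat -> 'rV[R]_d) (t : nat) : 'rV[R]_d :=
  match t with
  | 0%N => (f (x 0%N + delta *: u 0%N) / delta) *: u 0%N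
  | s.+1 =>
      ((f (x s.+1 + delta *: u s.+1) - f (x s + delta *: u s)) / delta)
        *: u s.+1
  end.

Definition uniform_index (R : realType) (dO : measure_display)
    (Omega : measurableType dO) (P : probability Omega R) (T : nat)
    (tau : {RV P >-> nat}) : Prop :=
  forall k, (k < T)%N -> P (tau @^-1` [set k]) = (T%:R^-1)%:E.

(* Main.v *)
(* With G(x) := E[f(x + delta v) v] / delta, the Cameron-Martin shift of the
   one-dimensional Gaussian, applied one coordinate at a time, gives
   |f_delta(x + h) - f_delta(x) - <G(x), h>| <= c sqrt(d) L0 / delta |h|^2
   for f merely Lipschitz. This yields both G = grad f_delta and the descent
   inequality
     E f_delta(x_(t+1)) <= E f_delta(x_t) - eta E|G(x_t)|^2
                           + eta^2 c sqrt(d) L0 / delta E|g_t|^2,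
   because the feedback g_t is an unbiased estimate of G(x_t): u_t is independent
   of the past and has mean 0, so the previous value of f does not contribute.
   The residual form of g_t and the Lipschitz bound give
     E|g_(t+1)|^2 <= 2 d (L0 eta / delta)^2 E|g_t|^2 + O(L0^2 d^2),
   whose factor is 1 / (2 eps T) < 1/2 for the prescribed eta and delta, so the
   second moments sum to at most 2 E|g_0|^2 + O(L0^2 d^2 T). Telescoping the
   descent inequality and dividing by eta T gives the rate. *)

Require Import Defs.
From HB Require Import structures.
From mathcomp Require Import all_boot all_order all_algebra.
From mathcomp Require Import finmap.
From mathcomp Require Import all_classical all_reals all_analysis.
From mathcomp Require Import measurable_realfun.
From mathcomp Require Import ring lra.

Set Implicit Arguments.
Unset Strict Implicit.
Unset Printing Implicit Defensive.

Import Order.TTheory GRing.Theory Num.Theory.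
Import numFieldNormedType.Exports.

Local Open Scope classical_set_scope.
Local Open Scope ring_scope.

(** * The standard normal law on the line *)

(** No derivative is ever taken under an integral sign, and no multidimensional density appears. The
    mean and the variance of the normal law also come out of the shift formula, as quantities linear
    in the shift that are bounded by its square. Working one coordinate at a time needs only
    integrals on the line; the price is the l1 norm of the increment, hence the [sqrt(d)].
    Conditional expectation is replaced by freezing: the past is the identity map into the sample
    space with a smaller sigma-algebra, [u t] is independent of it, and Fubini integrates [u t] out.
    As [f_delta] is defined by a vector [v] on an unrelated space, the inner integral is taken
    there; this is legitimate because all standard Gaussian vectors share one law. Since [f] is not
    assumed bounded, integrability along the iteration has to be propagated by induction on time.
    The prescribed parameters give [L0 / delta * sqrt(d) * eta = 1 / (2 sqrt(eps T))], so the noise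
    term of the descent inequality and [gap / (eta T)] carry the same factor [(eps T)^(-1/2)]. The
    [d^2] of the rate is that of the fourth moment of [|u|]. *)

Section density.
Local Open Scope ereal_scope.
Context d (T : measurableType d) (R : realType).
Variables (mu nu : {measure set T -> \bar R}) (p : T -> R).
Hypothesis mp : measurable_fun setT p.
Hypothesis p0 : forall x, (0 <= p x)%R.
Hypothesis nuE : forall A, measurable A -> nu A = \int[mu]_(x in A) (p x)%:E.
Import HBNNSimple.

(** Monotone convergence reduces the claim to simple functions, and [nuE] handles each of their
    level sets. It serves to turn Gaussian integrals into Lebesgue integrals, where translation is
    free. *)
Lemma ge0_integral_density (f : T -> \bar R) :
  measurable_fun setT f -> (forall x, 0 <= f x) ->
  \int[nu]_x f x = \int[mu]_x (f x * (p x)%:E).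
Proof.
move=> mf f0.
pose f_ := nnsfun_approx measurableT mf.
have f_f x : setT x -> EFin \o f_ ^~ x @ \oo --> f x.
  by move=> _; exact: cvg_nnsfun_approx.
have nd_f x : setT x -> {homo (fun n => (f_ n x)%:E) : n m / (n <= m)%N >-> n <= m}.
  by move=> _ m n mn; rewrite lee_fin; exact/lefP/nd_nnsfun_approx.
have mpE : measurable_fun setT (EFin \o p) by exact/measurable_EFinP.
transitivity (limn (fun n => \int[nu]_x (f_ n x)%:E)).
  rewrite -monotone_convergence//.
  - by apply: eq_integral => x _; apply/esym/cvg_lim => //; exact: f_f.
  - by move=> n; exact/measurable_EFinP.
  - by move=> n x _; rewrite lee_fin.
transitivity (limn (fun n => \int[mu]_x ((f_ n x)%:E * (p x)%:E))); last first.
  rewrite -monotone_convergence//.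
  - apply: eq_integral => x _; apply/cvg_lim => //.
    by apply: cvgeZr => //; exact: f_f.
  - by move=> n; apply: emeasurable_funM => //; exact/measurable_EFinP.
  - by move=> n x _; rewrite mule_ge0 ?lee_fin.
  - by move=> x _ m n mn; rewrite lee_wpmul2r ?lee_fin//; exact/lefP/nd_nnsfun_approx.
apply/congr_lim/funext => n.
under eq_integral do rewrite fimfunE -fsumEFin//.
rewrite ge0_integral_fsum//; last 2 first.
  - by move=> r; exact/measurable_EFinP/measurable_funM.
  - by move=> r x _; rewrite nnfun_muleindic_ge0.
transitivity (\int[mu]_x \sum_(r \in range (f_ n))
    ((r * \1_(f_ n @^-1` [set r]) x)%:E * (p x)%:E)); last first.
  apply: eq_integral => x _; rewrite -ge0_mule_fsuml; last first.
    by move=> r; exact: nnfun_muleindic_ge0.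
  by rewrite fsumEFin// -fimfunE.
rewrite ge0_integral_fsum//; last 2 first.
  - move=> r; apply: emeasurable_funM => //.
    by apply/measurable_EFinP/measurable_funM.
  - by move=> r x _; apply: mule_ge0; [exact: nnfun_muleindic_ge0|rewrite lee_fin].
apply: eq_fsbigr => r /[!inE] -[x _ <-{r}].
have fx0 : (0 <= f_ n x)%R by [].
rewrite (integralZl_indic _ (fun k => f_ n @^-1` [set k]))//; last by move=> /lt_geF; rewrite fx0.
rewrite integral_indic// setIT nuE//.
under [RHS]eq_integral do rewrite EFinM -muleA.
rewrite ge0_integralZl//; last 2 first.
- by apply: emeasurable_funM => //; exact/measurable_EFinP.
- by move=> y _; rewrite mule_ge0 ?lee_fin.
congr *%E; rewrite integral_mkcond.
by apply: eq_integral => y _; rewrite patchE indicE/=; case: ifP; rewrite ?mul1e ?mul0e.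
Qed.

End density.

(** Lebesgue measure is determined by the lengths of half-open intervals, and these are preserved by
    translation. *)
Lemma pushforward_lebesgue_shift (R : realType) (a : R) (A : set R) :
  measurable A ->
  pushforward lebesgue_measure ((fun x : R => x + a) : R -> measurableTypeR R) A
  = lebesgue_measure A.
Proof.
move=> mA.
have ms : measurable_fun setT ((fun x : R => x + a) : R -> measurableTypeR R).
  exact: measurable_funD.
apply/esym; pose m := pushforward lebesgue_measure ((fun x : R => x + a) : R -> measurableTypeR R).
apply: (@lebesgue_measure_unique R m) => //= _ [[b c]] _ <-.
rewrite /m /pushforward.
rewrite (_ : _ @^-1` _ = `]b - a, c - a]%classic).
  rewrite !lebesgue_measure_itv/= !lte_fin ltrD2r; case: ifP => // _.
  by rewrite -!EFinD; congr EFin; ring.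
by apply/seteqP; split => x/=; rewrite !in_itv/= ltrBlDr lerBrDr.
Qed.

(* [normal_prob] lives on an alias of [R]; this copy lives on [R] itself. *)
Definition std_normal (R : realType) : set R -> \bar R := normal_prob 0 1.

Section std_normal_measure.
Variable R : realType.

Let std_normal0 : std_normal set0 = 0%E :> \bar R.
Proof. exact: measure0 (@normal_prob R 0 1). Qed.

Let std_normal_ge0 A : (0 <= @std_normal R A)%E.
Proof. exact: measure_ge0 (@normal_prob R 0 1) A. Qed.

Let std_normal_sigma_additive : semi_sigma_additive (@std_normal R).
Proof. exact: (@measure_semi_sigma_additive _ _ _ (@normal_prob R 0 1)). Qed.

HB.instance Definition _ := isMeasure.Build _ _ _ (@std_normal R)
  std_normal0 std_normal_ge0 std_normal_sigma_additive.

Let std_normalT : std_normal [set: R] = 1%E.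
Proof. exact: integral_normal_pdf. Qed.

HB.instance Definition _ :=
  @Measure_isProbability.Build _ _ R (@std_normal R) std_normalT.

End std_normal_measure.

Section standard_normal.
Context {R : realType}.
Local Notation gam := (@std_normal R).
Implicit Types (a y : R).

(* Density at [y] of the standard normal law translated by [a], with respect to
   the untranslated law. *)
Definition tilt a y : R := expR (a * y - a ^+ 2 / 2).

Lemma measurable_tilt a : measurable_fun setT (tilt a).
Proof.
by apply: measurableT_comp => //; apply: measurable_funB.
Qed.

Lemma tilt_ge0 a y : 0 <= tilt a y. Proof. exact: expR_ge0. Qed.

Lemma normal_pdf_tilt a y :
  normal_pdf 0 1 (y - a) = tilt a y * normal_pdf 0 1 y.
Proof.
rewrite !normal_pdfE// mulrCA; congr *%R.
rewrite /normal_fun /tilt -expRD; congr expR.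
rewrite !subr0 expr1n; by field.
Qed.

Lemma measurable_idR : measurable_fun setT (idfun : measurableTypeR R -> R).
Proof. by move=> _ A mA; rewrite setTI; exact: mA. Qed.

Lemma ge0_integral_std_normal (F : R -> \bar R) :
  measurable_fun setT F -> (forall y, 0 <= F y)%E ->
  (\int[gam]_y F y = \int[lebesgue_measure]_y (F y * (normal_pdf 0 1 y)%:E))%E.
Proof.
move=> mF F0.
have := ge0_integral_pushforward measurable_idR (@normal_prob R 0 1) measurableT mF
  (fun y _ => F0 y).
rewrite [LHS](@eq_measure_integral _ _ _ _ gam); last by [].
move=> ->; rewrite preimage_setT.
have mF' : measurable_fun [set: measurableTypeR R] (F \o idfun) by exact: measurableT_comp mF measurable_idR.
apply: (@ge0_integral_density _ (measurableTypeR R) R lebesgue_measure (normal_prob 0 1)) => //.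
- exact: measurable_normal_pdf.
- by move=> x; exact: normal_pdf_ge0.
- exact: measurable_idR.
Qed.

Lemma ge0_integral_lebesgue_shift (H : measurableTypeR R -> \bar R) a :
  measurable_fun setT H -> (forall y, 0 <= H y)%E ->
  (\int[lebesgue_measure]_y H (y + a)%R = \int[lebesgue_measure]_y H y)%E.
Proof.
move=> mH H0.
pose s : measurableTypeR R -> measurableTypeR R := fun x : R => x + a.
have ms : measurable_fun setT s by exact: measurable_funD.
have := ge0_integral_pushforward ms lebesgue_measure measurableT mH (fun y _ => H0 y).
rewrite [LHS](@eq_measure_integral _ _ _ _ lebesgue_measure); first by move->.
by move=> A mA _; exact: pushforward_lebesgue_shift.
Qed.
(** Cameron-Martin on the line: both sides are Lebesgue integrals of
    [H z = F z * normal_pdf 0 1 (z - a)], the left one after a translation by [a]. *)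
Lemma ge0_normal_shift (F : R -> \bar R) a :
  measurable_fun setT F -> (forall y, 0 <= F y)%E ->
  (\int[gam]_y F (y + a)%R = \int[gam]_y (F y * (tilt a y)%:E))%E.
Proof.
move=> mF F0.
have ms : measurable_fun setT (fun x : R => x + a) by exact: measurable_funD.
rewrite ge0_integral_std_normal//; last exact: measurableT_comp mF ms.
rewrite ge0_integral_std_normal; last 2 first.
- by apply: emeasurable_funM => //; apply/measurable_EFinP; exact: measurable_tilt.
- by move=> y; rewrite mule_ge0// lee_fin tilt_ge0.
pose H z := (F z * (normal_pdf 0 1 (z - a))%:E)%E.
have mH : measurable_fun setT H.
  apply: emeasurable_funM => //; apply/measurable_EFinP.
  apply: measurableT_comp; first exact: measurable_normal_pdf.
  exact: measurable_funB.
have mH' : measurable_fun [set: measurableTypeR R] H.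
  exact: measurableT_comp mH measurable_idR.
have H0 z : (0 <= H z)%E by rewrite mule_ge0// lee_fin normal_pdf_ge0.
have E1 y : (H (y + a)%R = F (y + a)%R * (normal_pdf 0 1 y)%:E)%E.
  by rewrite /H addrK.
have E2 y : (H y = F y * (tilt a y)%:E * (normal_pdf 0 1 y)%:E)%E.
  by rewrite /H normal_pdf_tilt EFinM muleA.
transitivity (\int[lebesgue_measure]_y H (y + a)%R)%E.
  by apply: eq_integral => y _; rewrite E1.
rewrite ge0_integral_lebesgue_shift//.
by apply: eq_integral => y _; rewrite E2.
Qed.

(** The factor [tilt a] is nonnegative, so it passes through positive and negative parts and the
    nonnegative case applies to each. *)
Lemma normal_shift (h : R -> R) a : measurable_fun setT h ->
  \int[gam]_y h (y + a) = \int[gam]_y (h y * tilt a y).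
Proof.
move=> mh; have mhE : measurable_fun setT (EFin \o h) by exact/measurable_EFinP.
rewrite /Rintegral; congr fine; rewrite integralE [RHS]integralE.
rewrite (_ : (fun y => (h y * tilt a y)%:E)^\+%E =
             (fun y => (EFin \o h)^\+%E y * (tilt a y)%:E)%E); last first.
  apply/funext => y; rewrite !funeposE/= EFinM.
  by rewrite maxe_pMl ?lee_fin ?tilt_ge0// mul0e.
rewrite (_ : (fun y => (h y * tilt a y)%:E)^\-%E =
             (fun y => (EFin \o h)^\-%E y * (tilt a y)%:E)%E); last first.
  apply/funext => y; rewrite !funenegE/= -mulNr EFinM EFinN.
  by rewrite maxe_pMl ?lee_fin ?tilt_ge0// mul0e.
rewrite -!ge0_normal_shift//.
- by congr (_ - _)%E; apply: eq_integral => y _; rewrite ?funeposE ?funenegE.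
- exact: measurable_funeneg.
- exact: measurable_funepos.
Qed.

Lemma ge0_integral_tilt a : (\int[gam]_y (tilt a y)%:E = 1)%E.
Proof.
have := @ge0_normal_shift (cst 1%E) a (@measurable_cst _ _ _ _ _ _) (fun=> lee01).
rewrite integral_cst// mul1e [X in X = _](@probability_setT _ _ _ gam) => ->.
by apply: eq_integral => y _; rewrite mul1e.
Qed.

(** Up to the factor [expR (n^2 / 2)], [expR (n |y|)] is at most [tilt n y + tilt (- n) y], and
    every tilt has integral 1. All integrability on the line comes from this. *)
Lemma std_normal_integrable (h : R -> R) c n : measurable_fun setT h ->
  (forall y, `|h y| <= c * expR `|y| ^+ n) -> gam.-integrable setT (EFin \o h).
Proof.
move=> mh hc.
have mhE : measurable_fun setT (EFin \o h) by exact/measurable_EFinP.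
have mtilt b : measurable_fun setT (fun y => (tilt b y)%:E).
  by apply/measurable_EFinP; exact: measurable_tilt.
pose C := c * expR (n%:R ^+ 2 / 2).
have c0 : 0 <= c by have := hc 0; rewrite normr0 expR0 expr1n mulr1; apply: le_trans.
have C0 : 0 <= C by rewrite mulr_ge0// expR_ge0.
have itilt b : gam.-integrable setT (fun y => (tilt b y)%:E).
  apply/integrableP; split => //.
  under eq_integral do rewrite gee0_abs ?lee_fin ?tilt_ge0//.
  by rewrite ge0_integral_tilt ltry.
have ib b : gam.-integrable setT (fun y => (C * tilt b y)%:E).
  by under eq_fun do rewrite EFinM; exact: integrableZl.
apply: (@le_integrable _ _ _ gam _ measurableT _
  (fun y => (C * tilt n%:R y)%:E + (C * tilt (- n%:R) y)%:E)%E) => //.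
  move=> y _; rewrite /= lee_fin -mulrDr.
  rewrite [leRHS]ger0_norm; last by rewrite mulr_ge0// addr_ge0// tilt_ge0.
  apply: (le_trans (hc y)); rewrite /C -mulrA ler_wpM2l// mulrDr /tilt -!expRD.
  rewrite -expRM_natl sqrrN !mulNr.
  have [y0|y0] := ler0P y.
    apply: ler_wpDl; first exact: expR_ge0.
    by rewrite ler_expR; lra.
  apply: ler_wpDr; first exact: expR_ge0.
  by rewrite ler_expR; lra.
exact: integrableD.
Qed.

(** Multiplying [1 - t <= expR (- t)] by [expR t] gives [expR t - 1 <= t * expR t]. For positive [t]
    this is used twice; for [t <= 0] it is combined with [1 + t <= expR t]. *)
Lemma expR_taylor1 (t : R) : `|expR t - 1 - t| <= t ^+ 2 * expR `|t|.
Proof.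
have h1 := expR_ge1Dx t; have h2 := expR_ge1Dx (- t).
have e0 := expR_gt0 t.
have h3 : expR t * expR (- t) = 1 by rewrite -expRD subrr expR0.
rewrite ger0_norm; last by lra.
have h4 : expR t - 1 <= t * expR t by nra.
have [t0|t0] := ler0P t; last by nra.
have h5 : 1 <= expR (- t) by rewrite -[leLHS]expR0 ler_expR; lra.
nra.
Qed.

(** With [t = a y - a^2 / 2] the error is [(expR t - 1 - t) - a^2 / 2]. For [|a| <= 1], [|t|] is at
    most [|a| (1 + |y|)], so [a^2] factors out and the rest depends on [y] only. *)
Lemma tilt_taylor1 a y : `|a| <= 1 ->
  `|tilt a y - 1 - a * y| <= a ^+ 2 * (expR 1 ^+ 2 * expR `|y| ^+ 3).
Proof.
move=> a1.
have := expR_ge1Dx `|y|; have := expR_ge1Dx (1 : R).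
set e := expR 1; set E := expR `|y| => e2 E1.
have y0 : 0 <= `|y| by [].
rewrite /tilt; set t := a * y - _.
have tb : `|t| <= `|a| * (1 + `|y|).
  rewrite (le_trans (ler_normB _ _))// normrM mulrDr mulr1 addrC lerD2r.
  rewrite ger0_norm; last by rewrite mulr_ge0// sqr_ge0.
  by rewrite -real_normK ?num_real//; have := normr_ge0 a; nra.
have tb1 : `|t| <= 1 + `|y|.
  by apply: (le_trans tb); rewrite ler_piMl//; lra.
have et : expR `|t| <= e * E by rewrite /e /E -expRD ler_expR.
have t2 : t ^+ 2 <= a ^+ 2 * E ^+ 2.
  rewrite -[t ^+ 2]real_normK ?num_real// -[a ^+ 2]real_normK ?num_real//.
  rewrite -exprMn ler_sqr ?nnegrE ?mulr_ge0//; last by lra.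
  apply: (le_trans tb); rewrite ler_wpM2l//.
have -> : expR t - 1 - a * y = (expR t - 1 - t) - a ^+ 2 / 2.
  by rewrite /t; ring.
rewrite (le_trans (ler_normB _ _))//.
rewrite [X in _ + X]ger0_norm; last by rewrite mulr_ge0// sqr_ge0.
apply: (@le_trans _ _ (a ^+ 2 * E ^+ 2 * (e * E) + a ^+ 2 / 2)).
  rewrite lerD2r (le_trans (expR_taylor1 _))// ler_pM ?sqr_ge0 ?expR_ge0//.
have E31 : 1 <= E ^+ 3 by rewrite exprn_ege1//; lra.
have : 0 <= a ^+ 2 by rewrite sqr_ge0.
set A := a ^+ 2 => A0.
rewrite (_ : A * E ^+ 2 * (e * E) = A * (e * E ^+ 3)); last by ring.
rewrite -mulrDr ler_wpM2l//.
have : e * 1 <= e * E ^+ 3 by rewrite ler_wpM2l//; lra.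
(* Since [2 <= e], a second factor [e] pays for the term [a^2 / 2]. *)
have : 2 * (e * E ^+ 3) <= e * (e * E ^+ 3).
  by rewrite ler_wpM2r ?mulr_ge0//; lra.
by rewrite (_ : e ^+ 2 * E ^+ 3 = e * (e * E ^+ 3)); [lra|ring].
Qed.



Lemma tilt_integrable (h : R -> R) a c n : measurable_fun setT h ->
  (forall y, `|h y| <= c * expR `|y| ^+ n) -> `|a| <= 1 ->
  gam.-integrable setT (fun y => (h y * tilt a y)%:E).
Proof.
move=> mh hc a1.
have c0 : 0 <= c by have := hc 0; rewrite normr0 expR0 expr1n mulr1; apply: le_trans.
apply: (@std_normal_integrable (fun y => h y * tilt a y) c n.+1).
  exact: measurable_funM (measurable_tilt a).
move=> y; rewrite normrM exprSr mulrA ler_pM//.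
rewrite ger0_norm ?tilt_ge0// /tilt ler_expR.
have : `|a * y| <= `|y| by rewrite normrM ler_piMl.
by have := ler_norm (a * y); have := sqr_ge0 a; lra.
Qed.

(** Of the four factors [expR |y|], three come from [tilt_taylor1] and one from the linear growth of
    a Lipschitz function. The added 1 pays for the increment of order zero when the shift exceeds
    1. *)
Definition taylor_const : R :=
  1 + \int[gam]_y (expR 1 ^+ 2 * expR `|y| ^+ 4).

Let bnd (y : R) : R := expR 1 ^+ 2 * expR `|y| ^+ 4.

Let bnd_ge0 y : 0 <= bnd y.
Proof. by rewrite mulr_ge0// exprn_ge0// expR_ge0. Qed.

Let measurable_bnd : measurable_fun setT bnd.
Proof.
apply: measurable_funM => //; apply: measurable_funX.
by apply: measurableT_comp => //; exact: measurableT_comp.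
Qed.

Let integrable_bnd : gam.-integrable setT (EFin \o bnd).
Proof.
apply: (@std_normal_integrable bnd (expR 1 ^+ 2) 4) => // y.
by rewrite ger0_norm.
Qed.

Lemma taylor_const_ge1 : 1 <= taylor_const.
Proof. by rewrite lerDl; apply: Rintegral_ge0 => y _; exact: bnd_ge0. Qed.

Lemma norm_le_expR (y : R) : `|y| <= expR `|y|.
Proof. by have := expR_ge1Dx `|y|; lra. Qed.

Lemma integrable_pow n : gam.-integrable setT (fun y => (y ^+ n)%:E).
Proof.
apply: (@std_normal_integrable _ 1 n); first exact: measurable_funX.
by move=> y; rewrite mul1r normrX lerXn2r ?nnegrE ?expR_ge0 ?norm_le_expR.
Qed.

Lemma Rintegral_le_bnd (h : R -> R) c : 0 <= c -> measurable_fun setT h ->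
  (forall y, `|h y| <= c * bnd y) -> `|\int[gam]_y h y| <= c * (taylor_const - 1).
Proof.
move=> c0 mh hc.
have ih : gam.-integrable setT (EFin \o h).
  apply: (@std_normal_integrable h (c * expR 1 ^+ 2) 4) => // y.
  by rewrite -mulrA; exact: hc.
rewrite (le_trans (le_normr_Rintegral _ _))//.
rewrite /taylor_const addrAC subrr add0r -/bnd -RintegralZl//.
apply: le_Rintegral => //.
- by apply: integrable_norm.
- by under [X in _.-integrable _ X]eq_fun do rewrite /= EFinM; exact: integrableZl.
Qed.

(** Divide by [a] and let [a] tend to 0. Applied to expansions in the shift, this yields exact
    values of Gaussian moments. *)
Lemma linear_le_sqr_eq0 (z K : R) :
  (forall a, 0 < a -> a <= 1 -> a * `|z| <= K * a ^+ 2) -> z = 0.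
Proof.
move=> h; apply/normr0_eq0/eqP; rewrite eq_le normr_ge0 andbT.
have K0 : 0 <= K by have := h 1 ltr01 (lexx _); rewrite mul1r expr1n mulr1; apply: le_trans.
rewrite leNgt; apply/negP => z0.
(* Chosen so that [a <= 1] and [K * a < |z|] hold together. *)
pose a := `|z| / (K + K + `|z|).
have D0 : 0 < K + K + `|z| by lra.
have a0 : 0 < a by rewrite divr_gt0.
have a1 : a <= 1 by rewrite ler_pdivrMr// mul1r; lra.
have := h a a0 a1; rewrite mulrC expr2 mulrA ler_pM2r// => h1.
have : K * a < `|z|.
  by rewrite mulrA ltr_pdivrMr//; nra.
by rewrite ltNge h1.
Qed.

End standard_normal.

Section real_integrable.
Context {d} {T : measurableType d} {R : realType}.
Variable mu : {measure set T -> \bar R}.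
Implicit Types f g : T -> R.

Lemma integrableZR k f : mu.-integrable setT (fun x => (f x)%:E) ->
  mu.-integrable setT (fun x => (k * f x)%:E).
Proof. by move=> h; have := integrableZl measurableT k h. Qed.

Lemma integrableDR f g : mu.-integrable setT (fun x => (f x)%:E) ->
  mu.-integrable setT (fun x => (g x)%:E) ->
  mu.-integrable setT (fun x => (f x + g x)%:E).
Proof. by move=> hf hg; have := integrableD measurableT hf hg. Qed.

Lemma integrableBR f g : mu.-integrable setT (fun x => (f x)%:E) ->
  mu.-integrable setT (fun x => (g x)%:E) ->
  mu.-integrable setT (fun x => (f x - g x)%:E).
Proof. by move=> hf hg; have := integrableB measurableT hf hg. Qed.

Lemma integrable_leR f g : measurable_fun setT f -> (forall x, `|f x| <= g x) ->
  mu.-integrable setT (fun x => (g x)%:E) ->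
  mu.-integrable setT (fun x => (f x)%:E).
Proof.
move=> mf fg; apply: le_integrable => //; first exact/measurable_EFinP.
by move=> x _ /=; rewrite lee_fin (le_trans (fg x))// ler_norm.
Qed.

End real_integrable.

Section std_normal_taylor.
Context {R : realType}.
Local Notation gam := (@std_normal R).
Implicit Types (a y : R).

Lemma Rintegral_prob_cst d (T : measurableType d) (P : probability T R) (r : R) :
  \int[P]_x r = r.
Proof. by rewrite Rintegral_cst//= [P _]probability_setT/= mulr1. Qed.

Lemma integrable_tilt a : gam.-integrable setT (fun y => (tilt a y)%:E).
Proof.
apply/integrableP; split; first by apply/measurable_EFinP; exact: measurable_tilt.
under eq_integral do rewrite gee0_abs ?lee_fin ?tilt_ge0//.
by rewrite ge0_integral_tilt ltry.
Qed.

Lemma Rintegral_tilt a : \int[gam]_y tilt a y = 1.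
Proof. by rewrite /Rintegral ge0_integral_tilt. Qed.

Lemma integrable_id : gam.-integrable setT (fun y => y%:E).
Proof. exact: (@integrable_pow R 1). Qed.

Lemma integrable_prob_cst d (T : measurableType d) (P : probability T R) (r : R) :
  P.-integrable setT (fun=> r%:E).
Proof. exact: finite_measure_integrable_cst. Qed.

Lemma measurable_tilt_rem a : measurable_fun setT (fun y => tilt a y - 1 - a * y).
Proof.
apply: measurable_funB; last exact: measurable_funM.
by apply: measurable_funB => //; exact: measurable_tilt.
Qed.

Lemma integrable_tilt_rem a :
  gam.-integrable setT (fun y => (tilt a y - 1 - a * y)%:E).
Proof.
apply: integrableBR; last by apply: integrableZR; exact: integrable_id.
by apply: integrableBR; [exact: integrable_tilt|exact: integrable_prob_cst].
Qed.

Lemma Rintegral_tilt_rem a :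
  \int[gam]_y (tilt a y - 1 - a * y) = - (a * \int[gam]_y y).
Proof.
have ia : gam.-integrable setT (fun y => (a * y)%:E).
  by apply: integrableZR; exact: integrable_id.
rewrite RintegralB//; last first.
  by apply: integrableBR; [exact: integrable_tilt|exact: integrable_prob_cst].
rewrite RintegralB//; [|exact: integrable_tilt|exact: integrable_prob_cst].
by rewrite Rintegral_tilt Rintegral_prob_cst subrr sub0r RintegralZl//; exact: integrable_id.
Qed.

(* [Rintegral_tilt_rem] is linear in [a] and, by [tilt_taylor1], O(a^2). *)
Lemma std_normal_mean : \int[gam]_y y = 0.
Proof.
apply: (@linear_le_sqr_eq0 _ _ (taylor_const - 1)) => a a0 a1.
have a1' : `|a| <= 1 by rewrite ger0_norm// ltW.
rewrite -[in leLHS](ger0_norm (ltW a0)) -normrM -normrN -Rintegral_tilt_rem mulrC.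
apply: Rintegral_le_bnd; [exact: sqr_ge0|exact: measurable_tilt_rem|] => y.
rewrite (le_trans (tilt_taylor1 y a1'))// ler_wpM2l ?sqr_ge0//.
rewrite ler_wpM2l ?exprn_ge0 ?expR_ge0//.
apply: ler_weXn2l => //.
by have := expR_ge1Dx `|y|; have := normr_ge0 y; lra.
Qed.

Lemma lipschitz_measurable_fun (g : R -> R) (L : R) :
  (forall y z, `|g y - g z| <= L * `|y - z|) -> measurable_fun setT g.
Proof.
move=> gL; apply: continuous_measurable_fun => x.
have L0 : 0 <= L by have := gL 1 0; rewrite subr0 normr1 mulr1; apply: le_trans.
have L1 : 0 < L + 1 by lra.
apply/cvgrPdist_lt => e e0.
have : \forall y \near x, `|x - y| < e / (L + 1).
  have h : (fun y : R^o => y) @ (x : R^o) --> (x : R^o) by exact: cvg_id.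
  by move/cvgrPdist_lt: h => /(_ _ (divr_gt0 e0 L1)).
apply: filterS => y xy.
rewrite (le_lt_trans (gL x y))//.
apply: (@le_lt_trans _ _ ((L + 1) * `|x - y|)); first by rewrite ler_wpM2r//; lra.
by rewrite mulrC -ltr_pdivlMr.
Qed.

Lemma lipschitz_le (g : R -> R) (L : R) : (forall y z, `|g y - g z| <= L * `|y - z|) ->
  0 <= L /\ forall y, `|g y| <= (`|g 0| + L) * expR `|y|.
Proof.
move=> gL.
have L0 : 0 <= L by have := gL 1 0; rewrite subr0 normr1 mulr1; apply: le_trans.
split=> // y; rewrite mulrDl.
rewrite -[g y](subrK (g 0)) addrC (le_trans (ler_normD _ _))// lerD//.
  by rewrite ler_peMr// -expR0 ler_expR.
rewrite (le_trans (gL _ _))// subr0 ler_wpM2l//; exact: norm_le_expR.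
Qed.

(* First-order Taylor expansion of [a |-> E g(Y + a)] for [g] merely Lipschitz:
   by [normal_shift] the derivative falls on the Gaussian density. *)
Lemma std_normal_taylor (g : R -> R) (L a : R) :
  (forall y z, `|g y - g z| <= L * `|y - z|) ->
  `|\int[gam]_y g (y + a) - \int[gam]_y g y - a * \int[gam]_y (g y * y)|
    <= L * taylor_const * a ^+ 2.
Proof.
move=> gL; have [L0 gle] := lipschitz_le gL; have mg := lipschitz_measurable_fun gL.
have mga : measurable_fun setT (fun y => g (y + a)).
  by apply: (measurableT_comp mg); exact: measurable_funD.
set c := `|g 0| + L.
have c0 : 0 <= c by rewrite addr_ge0.
have ig : gam.-integrable setT (fun y => (g y)%:E).
  by apply: (@std_normal_integrable _ g c 1).
have igy : gam.-integrable setT (fun y => (g y * y)%:E).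
  apply: (@std_normal_integrable _ (fun y => g y * y) c 2); first exact: measurable_funM.
  by move=> y; rewrite normrM expr2 mulrA ler_pM// ?norm_le_expR.
have C1 := @taylor_const_ge1 R.
have m0 := std_normal_mean.
(* Centring [g] at 0, permitted by the zero mean, keeps [g 0] out of the constant. *)
have gyE : \int[gam]_y (g y * y) = \int[gam]_y ((g y - g 0) * y).
  rewrite [RHS](@eq_Rintegral _ _ _ _ _ (fun y => g y * y - g 0 * y)); last first.
    by move=> y _ /=; rewrite mulrBl.
  rewrite RintegralB//; last first.
    by apply: integrableZR; exact: integrable_id.
  by rewrite RintegralZl ?m0 ?mulr0 ?subr0//; exact: integrable_id.
have gb y : `|g y - g 0| <= L * expR `|y|.
  by rewrite (le_trans (gL _ _))// subr0 ler_wpM2l// norm_le_expR.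
have E1 y : 1 <= expR `|y| by rewrite -expR0 ler_expR.
have e1 : 1 <= expR (1 : R) by rewrite -expR0 ler_expR.
(* Small shifts use the expansion of the density. For [|a| > 1] the increment and the linear term
   are each bounded by a multiple of [|a|], which is below [a^2]. *)
have [a1|a1] := lerP `|a| 1.
- have igt : gam.-integrable setT (fun y => (g y * tilt a y)%:E).
    by apply: (@tilt_integrable _ g a c 1).
  rewrite normal_shift// -RintegralB// -RintegralZl// -RintegralB//; last 2 first.
  + exact: integrableBR.
  + by exact: integrableZR.
  (* The part proportional to [g 0] integrates to 0, by [Rintegral_tilt_rem] and the zero mean. *)
  rewrite (@eq_Rintegral _ _ _ _ _ (fun y => (g y - g 0) * (tilt a y - 1 - a * y)
     + g 0 * (tilt a y - 1 - a * y))); last by move=> y _ /=; ring.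
  have bound y : `|(g y - g 0) * (tilt a y - 1 - a * y)| <=
      L * a ^+ 2 * (expR 1 ^+ 2 * expR `|y| ^+ 4).
    rewrite normrM; apply: (le_trans (ler_pM _ _ (gb y) (tilt_taylor1 y a1))) => //.
    by rewrite le_eqVlt; apply/orP; left; apply/eqP; ring.
  have mp : measurable_fun setT (fun y => (g y - g 0) * (tilt a y - 1 - a * y)).
    by apply: measurable_funM; [exact: measurable_funB|exact: measurable_tilt_rem].
  rewrite RintegralD//; last 2 first.
  + apply: (@std_normal_integrable _ _ (L * a ^+ 2 * expR 1 ^+ 2) 4) => // y.
    by rewrite -mulrA; exact: bound.
  + by apply: integrableZR; exact: integrable_tilt_rem.
  rewrite RintegralZl//; last exact: integrable_tilt_rem.
  rewrite Rintegral_tilt_rem m0 mulr0 oppr0 mulr0 addr0.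
  have La0 : 0 <= L * a ^+ 2 by rewrite mulr_ge0// sqr_ge0.
  apply: (le_trans (Rintegral_le_bnd La0 mp bound)).
  rewrite [leRHS](_ : _ = L * a ^+ 2 * taylor_const); last by ring.
  by rewrite ler_wpM2l//; lra.
- have iga : gam.-integrable setT (fun y => (g (y + a))%:E).
    apply: (@std_normal_integrable _ (fun y => g (y + a)) (c * expR `|a|) 1) => // y.
    rewrite expr1 -mulrA -expRD (le_trans (gle _))// ler_wpM2l// ler_expR.
    by rewrite addrC ler_normD.
  have i1 : `|\int[gam]_y g (y + a) - \int[gam]_y g y| <= L * `|a|.
    rewrite -RintegralB//; apply: (le_trans (le_normr_Rintegral _ _)) => //.
      exact: integrableBR.
    rewrite -[leRHS](Rintegral_prob_cst gam); apply: le_Rintegral => //.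
    + by apply: integrable_norm => //; exact: integrableBR.
    + exact: integrable_prob_cst.
    + by move=> y _; rewrite (le_trans (gL _ _))// addrAC subrr add0r.
  have i2 : `|\int[gam]_y (g y * y)| <= L * (taylor_const - 1).
    rewrite gyE; apply: Rintegral_le_bnd => //.
      by apply: measurable_funM => //; exact: measurable_funB.
    move=> y; rewrite normrM.
    apply: (le_trans (ler_pM _ _ (gb y) (norm_le_expR y))) => //.
    rewrite -mulrA ler_wpM2l// -expr2.
    have h2 := E1 y; have h3 : 1 <= expR `|y| ^+ 2 by rewrite exprn_ege1.
    have h4 : 1 <= expR (1 : R) ^+ 2 by rewrite exprn_ege1.
    rewrite (_ : expR `|y| ^+ 4 = expR `|y| ^+ 2 * expR `|y| ^+ 2); last by ring.
    by rewrite mulrA ler_peMl ?exprn_ge0 ?expR_ge0// -[leLHS]mulr1 ler_pM.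
  have i3 : `|a * \int[gam]_y (g y * y)| <= `|a| * (L * (taylor_const - 1)).
    by rewrite normrM ler_wpM2l.
  rewrite (le_trans (ler_normB _ _))// (le_trans (lerD i1 i3))//.
  rewrite (_ : _ + _ = `|a| * (L * taylor_const)); last by ring.
  rewrite mulrC ler_wpM2l ?mulr_ge0//; first by lra.
  by rewrite -real_normK ?num_real// expr2 ler_peMl// ltW.
Qed.

(* Here again a quantity linear in [a] is O(a^2). *)
Lemma std_normal_second_moment : \int[gam]_y (y ^+ 2) = 1.
Proof.
apply/eqP; rewrite eq_sym -subr_eq0; apply/eqP.
apply: (@linear_le_sqr_eq0 _ _ taylor_const) => a a0 a1.
have := @std_normal_taylor id 1 a; rewrite mul1r.
under [X in _ - X - _]eq_Rintegral do rewrite /=.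
under [X in _ * X]eq_Rintegral do rewrite /= -expr2.
rewrite RintegralD//; [|exact: integrable_id|exact: integrable_prob_cst].
rewrite Rintegral_prob_cst std_normal_mean add0r subr0.
move=> h; rewrite -[in leLHS](ger0_norm (ltW a0)) -normrM mulrBr mulr1.
by apply: h => y z; rewrite mul1r.
Qed.

End std_normal_taylor.

(** * Independence and freezing *)

Section finite_intersections.
Context {Omega : Type} {I : choiceType}.
Variables (F : I -> set (set Omega)) (D : set I).

(** A pi-system generating the join of the [F i], [i] in [D], on which mutual independence can be
    read off directly. *)
Definition finite_intersections : set (set Omega) :=
  [set X | exists (J : {fset I}) (A : I -> set Omega),
     (forall i, i \in J -> D i /\ F i (A i)) /\ X = \bigcap_(i in [set` J]) A i].

Hypothesis FT : forall i, F i setT.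
Hypothesis FI : forall i, setI_closed (F i).

Lemma finite_intersections_setI : setI_closed finite_intersections.
Proof.
move=> _ _ [J [A [hA ->]]] [K [B [hB ->]]].
exists (J `|` K)%fset.
exists (fun i => (if i \in J then A i else setT) `&` (if i \in K then B i else setT)).
split=> [i /[!inE] iJK|].
  have Di : D i by case/orP: iJK => [/hA[]|/hB[]].
  split => //; apply: FI; first by case: ifP => // /hA[].
  by case: ifP => // /hB[].
apply/seteqP; split => w /=.
- move=> [wA wB] i /=; rewrite inE => _.
  by split; case: ifP => // iJ; [exact: wA|exact: wB].
- move=> h; split => i /= iJ; have := h i; rewrite /= inE iJ ?orbT/= => /(_ isT) [];
  by rewrite ?iJ.
Qed.

Lemma finite_intersectionsT : finite_intersections setT.
Proof.
exists fset0, (fun=> setT); split; first by move=> i; rewrite inE.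
by apply/seteqP; split => w //= _ i /=; rewrite inE.
Qed.

Lemma sub_finite_intersections i : D i -> F i `<=` finite_intersections.
Proof.
move=> Di A FA; exists [fset i]%fset, (fun=> A); split.
  by move=> j /[!inE] /eqP ->.
apply/seteqP; split => w /= h; first by [].
by apply: (h i); rewrite /= inE.
Qed.

End finite_intersections.

Section independence.
Context {dO} {Omega : measurableType dO} {R : realType} (P : probability Omega R).

(** For fixed [B], the finite measures [P (X n B)] and [P B * P X] in [X] agree on the pi-system of
    finite intersections, hence on the sigma-algebra it generates. *)
Lemma mutually_independent_join (I : choiceType) (F : I -> set (set Omega))
    (D : set I) (i0 : I) (A B : set Omega) :
  (forall i, F i `<=` measurable) -> (forall i, F i setT) ->
  (forall i, setI_closed (F i)) -> mutually_independent P F ->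
  ~ D i0 -> <<s \bigcup_(i in D) F i >> A -> F i0 B ->
  P (A `&` B) = (P A * P B)%E.
Proof.
move=> Fm FT FI indF Di0 sA FB.
have mB : measurable B by exact: Fm FB.
set G := finite_intersections F D.
have Gm : G `<=` measurable.
  move=> _ [J [C [hC ->]]]; apply: fin_bigcap_measurable => // i /= iJ.
  by apply: (Fm i); have [] := hC i iJ.
have sGA : <<s G >> A.
  apply: sub_sigma_algebra2 sA => X [i Di FX].
  exact: sub_finite_intersections FX.
have PBfin : P B \is a fin_num by exact: fin_num_measure.
have PB0 : 0 <= fine (P B) by exact: fine_ge0.
pose m2 := mscale (NngNum PB0) P.
have m2E X : m2 X = (P B * P X)%E by rewrite -[in RHS](fineK PBfin).
have key X : G X -> P (X `&` B) = (P B * P X)%E.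
  move=> [J [C [hC ->]]].
  have iJ : i0 \notin J by apply/negP => /hC[].
  (* [B] joins the family as a further event at the fresh index [i0], so independence applies to [J]
     enlarged by [i0]. *)
  pose C' i := if i == i0 then B else C i.
  have -> : (\bigcap_(i in [set` J]) C i) `&` B =
            \bigcap_(i in [set` (i0 |` J)%fset]) C' i.
    apply/seteqP; split => w /=.
    + move=> [wC wB] i /=; rewrite !inE /C' => /orP[/eqP->|iJ']; first by rewrite eqxx.
      by case: ifP => // _; exact: wC.
    + move=> h; split.
        move=> i /= iJ'; have := h i; rewrite /= !inE iJ' orbT => /(_ isT).
        by rewrite /C'; case: eqP => // E; rewrite E (negbTE iJ) in iJ'.
      by have := h i0; rewrite /= !inE eqxx => /(_ isT); rewrite /C' eqxx.
  rewrite indF; last first.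
    by move=> i; rewrite !inE /C'; case: eqP => [-> //|_ /= /hC[]].
  rewrite indF; last by move=> i /hC[].
  rewrite big_fsetU1//=; congr *%E; first by rewrite /C' eqxx.
  rewrite big_seq [RHS]big_seq; apply: eq_bigr => i iJ'.
  by rewrite /C'; case: eqP => // E; rewrite E (negbTE iJ) in iJ'.
have e : mrestr P mB A = m2 A.
  apply: (@g_sigma_algebra_measure_unique _ R Omega G Gm (fun=> setT)
    (fun _ => finite_intersectionsT F D) _ (mrestr P mB) m2
    (finite_intersections_setI FT FI) _ _ A sGA).
  - by rewrite bigcup_const.
  - by move=> X GX; exact: etrans (key X GX) (esym (m2E X)).
  - have h : (P (setT `&` B) < +oo)%E by rewrite setTI ltey_eq PBfin.
    by move=> _; exact: h.
exact: etrans e (etrans (m2E A) (muleC _ _)).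
Qed.

End independence.

Section freezing.
Local Open Scope ereal_scope.
Context {dO d1 d2} {Omega : measurableType dO} {T1 : measurableType d1}
  {T2 : measurableType d2} {R : realType}.
Variables (P : probability Omega R) (gam : probability T2 R).
Variables (Y : Omega -> T1) (U : Omega -> T2).
Hypotheses (mY : measurable_fun setT Y) (mU : measurable_fun setT U).
Hypothesis lawU : forall B, measurable B -> P (U @^-1` B) = gam B.
Hypothesis indYU : forall A B, measurable A -> measurable B ->
  P (Y @^-1` A `&` U @^-1` B) = P (Y @^-1` A) * P (U @^-1` B).

Let pY : {mfun Omega >-> T1} := HB.pack Y (isMeasurableFun.Build _ _ _ _ _ mY).

Let mYU : measurable_fun setT (fun w => (Y w, U w)).
Proof. exact: measurable_fun_pair. Qed.

Let pYU : {mfun Omega >-> (T1 * T2)%type} :=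
  HB.pack (fun w => (Y w, U w)) (isMeasurableFun.Build _ _ _ _ _ mYU).

Lemma freezing_law (X : set (T1 * T2)) : measurable X ->
  distribution P pYU X = (distribution P pY \x gam) X.
Proof.
move=> mX; apply/esym; apply: product_measure_unique mX => A B mA mB.
by have h := indYU mA mB; rewrite lawU// in h; exact: h.
Qed.

(* A random variable [U] independent of [Y] can be integrated out with [Y] held
   fixed. *)
Lemma ge0_freezing (h : T1 * T2 -> \bar R) :
  measurable_fun setT h -> (forall z, 0 <= h z) ->
  \int[P]_w h (Y w, U w) = \int[P]_w \int[gam]_y h (Y w, y).
Proof.
move=> mh h0.
have mF : measurable_fun setT (fubini_F gam h) by exact: measurable_fun_fubini_tonelli_F.
have F0 x : 0 <= fubini_F gam h x by exact: integral_ge0.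
transitivity (\int[distribution P pYU]_z h z).
  by rewrite ge0_integral_distribution.
transitivity (\int[distribution P pY \x gam]_z h z).
  by apply: eq_measure_integral => A mA _; exact: freezing_law.
by rewrite fubini_tonelli1// ge0_integral_distribution.
Qed.

Lemma freezing (h : T1 * T2 -> R) :
  measurable_fun setT h -> (forall t, gam.-integrable setT (fun y => (h (t, y))%:E)) ->
  P.-integrable setT (fun w => (h (Y w, U w))%:E) ->
  P.-integrable setT (fun w => (\int[gam]_y h (Y w, y))%R%:E) /\
  (\int[P]_w h (Y w, U w) = \int[P]_w \int[gam]_y h (Y w, y))%R.
Proof.
move=> mh hi ih.
have mhE : measurable_fun setT (EFin \o h) by exact/measurable_EFinP.
(* Integrability of every section makes the real inner integral agree with the extended one at every
   [t], not only almost everywhere. *)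
have innerE t : (\int[gam]_y h (t, y))%R%:E = fubini_F gam (EFin \o h) t.
  by rewrite /fubini_F /Rintegral fineK//; exact: integrable_fin_num.
have lawE (k : T1 * T2 -> \bar R) :
    \int[distribution P pYU]_z k z = \int[distribution P pY \x gam]_z k z.
  by apply: eq_measure_integral => A mA _; exact: freezing_law.
have ihp : (distribution P pY \x gam).-integrable setT (EFin \o h).
  apply/integrableP; split => //.
  rewrite -lawE ge0_integral_distribution//; last exact: measurableT_comp.
  by have /integrableP[] := ih.
have iF := integrable_fubini_F ihp.
have mF := measurable_fubini_F ihp.
have iFY : P.-integrable setT (fubini_F gam (EFin \o h) \o Y).
  have /integrableP[_ h2] := iF; apply/integrableP; split.
    exact: measurableT_comp mF mY.
  have mA : measurable_fun setT (abse \o fubini_F gam (EFin \o h)) by exact: measurableT_comp.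
  have := @ge0_integral_distribution _ _ _ _ _ P pY (abse \o fubini_F gam (EFin \o h))
    mA (fun y => abse_ge0 _).
  by move=> <-; exact: h2.
split; first by under eq_fun do rewrite innerE; exact: iFY.
rewrite /Rintegral; congr fine.
under [RHS]eq_integral do rewrite innerE.
transitivity (\int[distribution P pYU]_z (EFin \o h) z).
  by rewrite integral_distribution.
rewrite lawE -integral12_prod_meas1//.
by rewrite integral_distribution.
Qed.

End freezing.

(** * Borel structure and Gaussian vectors in R^d *)

Section enorm.
Context {R : realType} {d : nat}.
Implicit Types x y : 'rV[R]_d.

(** Nonnegativity of the empirical variance: the squared deviations from the mean [S / N] sum to
    [Q - S^2 / N]. *)
Lemma sqr_sum_le (n : nat) (a : 'I_n -> R) :
  (\sum_i a i) ^+ 2 <= n%:R * \sum_i a i ^+ 2.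
Proof.
case: n a => [|n] a; first by rewrite !big_ord0 mulr0 expr0n.
set S := \sum_i a i; set Q := \sum_i a i ^+ 2; set N : R := n.+1%:R.
have N0 : 0 < N by rewrite ltr0n.
have : 0 <= \sum_i (a i - S / N) ^+ 2 by apply: sumr_ge0 => i _; exact: sqr_ge0.
have -> : \sum_i (a i - S / N) ^+ 2 = Q - S ^+ 2 / N.
  under eq_bigr do rewrite sqrrB.
  rewrite big_split/= sumrB sumr_const card_ord -/Q.
  under [X in _ - X + _]eq_bigr do rewrite -mulr_natr -mulrA.
  rewrite -mulr_suml -/S -[X in _ + X = _]mulr_natl -/N.
  field; exact: lt0r_neq0.
by rewrite subr_ge0 ler_pdivrMr// mulrC.
Qed.

Lemma enorm_ge0 x : 0 <= enorm x. Proof. exact: sqrtr_ge0. Qed.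

Lemma sqr_enorm x : enorm x ^+ 2 = \sum_(i < d) x ord0 i ^+ 2.
Proof. by rewrite sqr_sqrtr// sumr_ge0// => i _; exact: sqr_ge0. Qed.

Lemma ler_enorm x y : (forall i, `|x ord0 i| <= `|y ord0 i|) -> enorm x <= enorm y.
Proof.
move=> h; rewrite ler_sqrt; last by rewrite sumr_ge0// => i _; exact: sqr_ge0.
apply: ler_sum => i _; rewrite -[x _ _ ^+ 2]real_normK ?num_real//.
by rewrite -[leRHS]real_normK ?num_real// lerXn2r ?nnegrE.
Qed.

Lemma enormZ (a : R) x : enorm (a *: x) = `|a| * enorm x.
Proof.
rewrite /enorm -sqrtr_sqr -sqrtrM ?sqr_ge0//; congr Num.sqrt.
by rewrite mulr_sumr; apply: eq_bigr => i _; rewrite mxE exprMn.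
Qed.

Lemma sqr_enormD_le x y : enorm (x + y) ^+ 2 <= 2 * enorm x ^+ 2 + 2 * enorm y ^+ 2.
Proof.
rewrite !sqr_enorm !mulr_sumr -big_split/=; apply: ler_sum => i _; rewrite mxE.
have := sqr_ge0 (x ord0 i - y ord0 i); nra.
Qed.

Lemma enorm_le_sum x : enorm x <= \sum_(i < d) `|x ord0 i|.
Proof.
have S0 : 0 <= \sum_(i < d) `|x ord0 i| by exact: sumr_ge0.
rewrite -(@ler_pXn2r _ 2) ?nnegrE ?enorm_ge0// sqr_enorm.
rewrite [leRHS]expr2 mulr_suml; apply: ler_sum => i _.
rewrite -real_normK ?num_real// expr2 ler_wpM2l//.
by rewrite (bigD1 i)//= lerDl sumr_ge0.
Qed.

Lemma sum_le_enorm x : \sum_(i < d) `|x ord0 i| <= Num.sqrt d%:R * enorm x.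
Proof.
have S0 : 0 <= \sum_(i < d) `|x ord0 i| by exact: sumr_ge0.
rewrite -(@ler_pXn2r _ 2) ?nnegrE ?mulr_ge0 ?sqrtr_ge0 ?enorm_ge0//.
rewrite exprMn sqr_sqrtr ?ler0n// sqr_enorm (le_trans (sqr_sum_le _))//.
rewrite ler_wpM2l ?ler0n//; apply: ler_sum => i _.
by rewrite real_normK ?num_real.
Qed.

Lemma enorm_coord x i : `|x ord0 i| <= enorm x.
Proof.
rewrite -(@ler_pXn2r _ 2) ?nnegrE ?enorm_ge0// sqr_enorm real_normK ?num_real//.
by rewrite (bigD1 i)//= lerDl sumr_ge0// => j _; exact: sqr_ge0.
Qed.

Lemma enorm_delta (a : R) i : enorm (a *: delta_mx ord0 i : 'rV[R]_d) = `|a|.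
Proof.
rewrite enormZ (_ : enorm _ = 1) ?mulr1//.
rewrite /enorm (bigD1 i)//= big1 ?addr0; last first.
  by move=> j ji; rewrite mxE eqxx (negbTE ji) expr0n.
by rewrite mxE !eqxx expr1n sqrtr1.
Qed.

End enorm.

Section measurable_rV.
Context {R : realType} {d : nat}.

Definition coord_cylinders : set (set 'rV[R]_d) :=
  \bigcup_i preimage_set_system setT (fun x : 'rV[R]_d => x ord0 i) measurable.

(* Row vectors with their Borel sigma-algebra, which [matrix] does not carry. *)
Definition rVm : Type := g_sigma_algebraType coord_cylinders.
HB.instance Definition _ := Measurable.on rVm.

Lemma measurable_coord (i : 'I_d) :
  measurable_fun setT (fun x : rVm => (x : 'rV[R]_d) ord0 i).
Proof.
move=> _ B mB; apply: sub_sigma_algebra; exists i => //; exists B => //.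
Qed.

Lemma measurable_fun_rV d1 (T : measurableType d1) (X : T -> rVm) :
  (forall i, measurable_fun setT (fun t => (X t : 'rV[R]_d) ord0 i)) ->
  measurable_fun setT X.
Proof.
move=> hX; apply: (@measurability _ _ _ _ setT X coord_cylinders) => //.
move=> _ [_ [i _ [B mB <-]] <-].
by have := hX i measurableT B mB; rewrite !setTI.
Qed.

End measurable_rV.
Arguments rVm : clear implicits.

Section lipschitz_measurable.
Context {R : realType} {d : nat}.

Lemma rat_approx (x : 'rV[R]_d) (e : R) : 0 < e ->
  exists q : 'rV[rat]_d, \sum_(i < d) `|x ord0 i - ratr (q ord0 i)| < e.
Proof.
move=> e0.
have D0 : 0 < (d%:R + 1 : R) by rewrite ltr_wpDl.
have /choice[q hq] : forall i, exists q : rat,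
    `|x ord0 i - ratr q| < e / (d%:R + 1).
  move=> i.
  have h : x ord0 i - e / (d%:R + 1) < x ord0 i + e / (d%:R + 1).
    by have := divr_gt0 e0 D0; lra.
  have [q] := rat_in_itvoo h; rewrite in_itv/= => /andP[q1 q2].
  by exists q; rewrite ltr_norml; apply/andP; split; lra.
exists (\row_i q i); under eq_bigr do rewrite mxE.
apply: (@le_lt_trans _ _ (\sum_(i < d) e / (d%:R + 1))).
  by apply: ler_sum => i _; exact: ltW.
rewrite sumr_const card_ord -[ltLHS]mulr_natr -mulrA -[ltRHS]mulr1 ltr_pM2l//.
by rewrite mulrC ltr_pdivrMr// mul1r ltrDl.
Qed.

(* A Lipschitz function is the infimum of countably many measurable cones. *)
Lemma lipschitz_measurable (f : 'rV[R]_d -> R) (L : R) :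
  (forall y z, `|f y - f z| <= L * enorm (y - z)) ->
  measurable_fun [set: rVm R d] f.
Proof.
(* In dimension 0 the Lipschitz hypothesis leaves the sign of [L] open. *)
move=> fL; pose M := `|L|.
have {fL} fL y z : `|f y - f z| <= M * \sum_(i < d) `|y ord0 i - z ord0 i|.
  apply: (le_trans (fL y z)).
  apply: (@le_trans _ _ (M * enorm (y - z))).
    by rewrite ler_wpM2r ?enorm_ge0// ler_norm.
  rewrite ler_wpM2l ?normr_ge0//; apply: (le_trans (enorm_le_sum _)).
  by apply: ler_sum => i _; rewrite !mxE.
pose r (q : 'rV[rat]_d) : 'rV[R]_d := map_mx ratr q.
pose cone (q : 'rV[rat]_d) (x : rVm R d) : R :=
  f (r q) + M * \sum_(i < d) `|(x : 'rV[R]_d) ord0 i - ratr (q ord0 i)|.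
have mcone q : measurable_fun setT (cone q).
  apply: measurable_funD => //; apply: measurable_funM => //.
  apply: measurable_sum => i; apply: measurableT_comp => //.
  by apply: measurable_funB => //; exact: measurable_coord.
(* Each cone lies above [f], and rational centres near [x] bring the cones arbitrarily close to
   [f x]; [unpickle] enumerates the centres. *)
have key c : [set x : rVm R d | f x < c] =
    \bigcup_(n : nat) (if (choice.unpickle n : option 'rV[rat]_d) is Some q then [set x | cone q x < c] else set0).
  apply/seteqP; split => x /=.
    move=> fxc.
    (* At l1 distance [S] from the centre the cone exceeds [f x] by at most [2 M S]; the added 1
       keeps the denominator positive. *)
    have e0 : 0 < (c - f x) / (M + M + 1).
      by rewrite divr_gt0 ?subr_gt0//; have := normr_ge0 L; rewrite -/M; lra.
    have [q hq] := rat_approx (x : 'rV[R]_d) e0.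
    exists (choice.pickle q) => //; rewrite choice.pickleK /= /cone.
    have h1 := fL (r q) (x : 'rV[R]_d).
    have h2 : \sum_(i < d) `|r q ord0 i - (x : 'rV[R]_d) ord0 i| =
              \sum_(i < d) `|(x : 'rV[R]_d) ord0 i - ratr (q ord0 i)|.
      by apply: eq_bigr => i _; rewrite distrC mxE.
    rewrite h2 in h1; set S := \sum_(i < d) _ in hq h1 *.
    rewrite ltr_pdivlMr in hq; last by have := normr_ge0 L; rewrite -/M; lra.
    have := ler_norm (f (r q) - f x).
    have : 0 <= S by exact: sumr_ge0.
    by lra.
  move=> [n _]; case: choice.unpickle => [q|//] /=; rewrite /cone => h.
  have := ler_norm (f x - f (r q)); have := fL (x : 'rV[R]_d) (r q).
  have -> : \sum_(i < d) `|(x : 'rV[R]_d) ord0 i - r q ord0 i| =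
            \sum_(i < d) `|(x : 'rV[R]_d) ord0 i - ratr (q ord0 i)|.
    by apply: eq_bigr => i _; rewrite mxE.
  by lra.
apply: (@measurability _ _ (rVm R d) R setT f (@RGenCInfty.G R)); first exact: RGenCInfty.measurableE.
move=> _ [_ [c ->] <-]; rewrite setTI.
rewrite (_ : _ @^-1` _ = ~` [set x : rVm R d | f x < c]); last first.
  by apply/seteqP; split => x /=; rewrite in_itv/= andbT leNgt => /negP.
apply: measurableC; rewrite key; apply: bigcupT_measurable => n.
case: choice.unpickle => [q|]; last exact: measurable0.
rewrite (_ : [set x | _] = cone q @^-1` `]-oo, c[%classic); last first.
  by apply/seteqP; split => x /=; rewrite in_itv.
by rewrite -[X in measurable X]setTI; apply: mcone => //; exact: measurable_itv.
Qed.

End lipschitz_measurable.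

Section sigma_vector.
Context {dO} {Omega : measurableType dO} {R : realType} {d : nat}.
Variable U : Omega -> 'rV[R]_d.

Lemma sigma_vector_preimage (B : set (rVm R d)) :
  measurable B -> sigma_vector U (U @^-1` B).
Proof.
move=> mB.
pose G := \big[setU/set0]_(i < d)
  preimage_set_system setT (coordinate U i) measurable.
have mU : measurable_fun setT (U : g_sigma_algebraType G -> rVm R d).
  apply: measurable_fun_rV => i _ C mC; apply: sub_sigma_algebra.
  by rewrite /G (bigD1 i)//=; left; exists C.
by have := mU measurableT B mB; rewrite setTI.
Qed.

Lemma sigma_vector_measurable : (forall i, measurable_fun setT (coordinate U i)) ->
  sigma_vector U `<=` measurable.
Proof.
move=> mU; apply: smallest_sub; first exact: sigma_algebra_measurable.
elim/big_ind: _ => //; first by move=> A B hA hB X [/hA|/hB].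
by move=> i _ _ [C mC <-]; exact: mU.
Qed.

Lemma sigma_vectorT : sigma_vector U setT.
Proof.
pose G := \big[setU/set0]_(i < d)
  preimage_set_system setT (coordinate U i) measurable.
exact: (@measurableT _ (g_sigma_algebraType G)).
Qed.

Lemma sigma_vector_setI : setI_closed (sigma_vector U).
Proof.
pose G := \big[setU/set0]_(i < d)
  preimage_set_system setT (coordinate U i) measurable.
exact: (@measurableI _ (g_sigma_algebraType G)).
Qed.

End sigma_vector.

Section gaussian_law.
Context {R : realType} {d : nat}.

Lemma gaussian_measurable dO (Omega : measurableType dO) (P : probability Omega R)
  (U : Omega -> 'rV[R]_d) : standard_gaussian P U ->
  measurable_fun setT (U : Omega -> rVm R d).
Proof. by move=> [mU _ _]; exact: measurable_fun_rV. Qed.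

Definition coord_preimage (i : 'I_d) : set (set 'rV[R]_d) :=
  preimage_set_system setT (fun x : 'rV[R]_d => x ord0 i) measurable.

(** On finite intersections of coordinate cylinders both laws are products of [std_normal], and
    these cylinders generate the Borel sets. This lets [v] replace each [u t] inside an integral. *)
Lemma gaussian_law dO (Omega : measurableType dO) (P : probability Omega R)
  (U : Omega -> 'rV[R]_d) dS (S : measurableType dS) (Q : probability S R)
  (v : S -> 'rV[R]_d) (B : set (rVm R d)) :
  standard_gaussian P U -> standard_gaussian Q v -> measurable B ->
  P (U @^-1` B) = Q (v @^-1` B).
Proof.
move=> gU gv mB.
have mU := gaussian_measurable gU; have mv := gaussian_measurable gv.
pose pU : {mfun Omega >-> rVm R d} :=
  HB.pack (U : Omega -> rVm R d) (isMeasurableFun.Build _ _ _ _ _ mU).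
pose pv : {mfun S >-> rVm R d} :=
  HB.pack (v : S -> rVm R d) (isMeasurableFun.Build _ _ _ _ _ mv).
pose G : set (set (rVm R d)) := finite_intersections coord_preimage setT.
have FT i : coord_preimage i setT.
  by exists setT; [exact: measurableT|rewrite setTI preimage_setT].
have FI i : setI_closed (coord_preimage i).
  move=> _ _ [A mA <-] [C mC <-]; exists (A `&` C); first exact: measurableI.
  by rewrite !setTI.
have Gm : G `<=` (@measurable _ (rVm R d)).
  move=> _ [J [C [hC ->]]]; apply: fin_bigcap_measurable => // i /= iJ.
  by apply: sub_sigma_algebra; exists i => //; have [] := hC i iJ.
have sGB : <<s G >> B.
  apply: sub_sigma_algebra2 mB => X [i _ FX].
  exact: (@sub_finite_intersections _ _ coord_preimage setT i I X FX).
(* The diagonal map [y |-> \row_j y] recovers the base of the cylinder [C i] without choosing it, so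
   the right-hand side does not mention [W]. *)
have prod (d1 : measure_display) (T : measurableType d1) (M : probability T R) (W : T -> 'rV[R]_d) :
    standard_gaussian M W -> forall (J : {fset 'I_d}) C,
    (forall i, i \in J -> coord_preimage i (C i)) ->
    M (W @^-1` (\bigcap_(i in [set` J]) C i)) =
    (\prod_(i <- J) std_normal ((fun y => \row_(j < d) y) @^-1` (C i)))%E.
  move=> [mW lW iW] J C hC.
  have -> : W @^-1` (\bigcap_(i in [set` J]) C i) =
            \bigcap_(i in [set` J]) (W @^-1` (C i)) by [].
  rewrite iW; last first.
    by move=> i iJ; have [A mA <-] := hC i iJ; exists A => //; rewrite !setTI.
  rewrite big_seq [RHS]big_seq; apply: eq_bigr => i iJ.
  have [A mA <-] := hC i iJ; rewrite !setTI.
  rewrite (_ : W @^-1` _ = coordinate W i @^-1` A)// lW//.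
  by congr (std_normal _); apply/seteqP; split => y /=; rewrite mxE.
suff : distribution P pU B = distribution Q pv B by [].
apply: (@g_sigma_algebra_measure_unique _ R (rVm R d) G Gm (fun=> setT)
    (fun _ => finite_intersectionsT coord_preimage setT) _ (distribution P pU)
    (distribution Q pv) (finite_intersections_setI FT FI) _ _ B sGB).
- by rewrite bigcup_const.
- move=> _ [J [C [hC ->]]].
  have hC' i : i \in J -> coord_preimage i (C i) by move=> /hC[].
  exact: etrans (prod _ _ _ _ gU J C hC') (esym (prod _ _ _ _ gv J C hC')).
- move=> _; apply: (@le_lt_trans _ _ 1%E); last exact: ltry.
  exact: probability_le1.
Qed.

End gaussian_law.

Lemma integrable_sumR d (T : measurableType d) (R : realType)
    (mu : {measure set T -> \bar R}) (I : finType) (f : I -> T -> R) :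
  (forall i, mu.-integrable setT (fun x => (f i x)%:E)) ->
  mu.-integrable setT (fun x => (\sum_i f i x)%:E).
Proof.
move=> hf; under eq_fun do rewrite -sumEFin.
by apply: (integrable_sum measurableT) => i _; exact: hf.
Qed.

Lemma Rintegral_sum d (T : measurableType d) (R : realType)
    (mu : {measure set T -> \bar R}) (I : finType) (f : I -> T -> R) :
  (forall i, mu.-integrable setT (fun x => (f i x)%:E)) ->
  \int[mu]_x (\sum_i f i x) = \sum_i \int[mu]_x f i x.
Proof.
move=> hf; apply: EFin_inj; rewrite -sumEFin /Rintegral.
rewrite fineK; last by apply: integrable_fin_num => //; exact: integrable_sumR.
under eq_integral do rewrite -sumEFin.
rewrite integral_sum//; apply: eq_bigr => i _.
by rewrite fineK//; exact: integrable_fin_num (hf i).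
Qed.

Section freezing_rv.
Local Open Scope ereal_scope.
Context {dO dS d1 d2} {Omega : measurableType dO} {S : measurableType dS}
  {T1 : measurableType d1} {T2 : measurableType d2} {R : realType}.
Variables (P : probability Omega R) (Q : probability S R).
Variables (Y : Omega -> T1) (U : Omega -> T2) (V : S -> T2).
Hypotheses (mY : measurable_fun setT Y) (mU : measurable_fun setT U).
Hypothesis mV : measurable_fun setT V.
Hypothesis lawU : forall B, measurable B -> P (U @^-1` B) = Q (V @^-1` B).
Hypothesis indYU : forall A B, measurable A -> measurable B ->
  P (Y @^-1` A `&` U @^-1` B) = P (Y @^-1` A) * P (U @^-1` B).

Let pV : {mfun S >-> T2} := HB.pack V (isMeasurableFun.Build _ _ _ _ _ mV).

(** Freezing with the inner integral pulled back to the space of [V], a variable with the law of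
    [U]; this is the form in which smoothed quantities appear. *)
Lemma ge0_freezing_rv (h : T1 * T2 -> \bar R) :
  measurable_fun setT h -> (forall z, 0 <= h z) ->
  \int[P]_w h (Y w, U w) = \int[P]_w \int[Q]_s h (Y w, V s).
Proof.
move=> mh h0.
rewrite (@ge0_freezing _ _ _ _ _ _ _ P (distribution Q pV) Y U)//.
apply: eq_integral => w _; rewrite ge0_integral_distribution//.
exact: measurableT_comp.
Qed.

Lemma freezing_rv (h : T1 * T2 -> R) :
  measurable_fun setT h -> (forall t, Q.-integrable setT (fun s => (h (t, V s))%:E)) ->
  P.-integrable setT (fun w => (h (Y w, U w))%:E) ->
  P.-integrable setT (fun w => (\int[Q]_s h (Y w, V s))%R%:E) /\
  (\int[P]_w h (Y w, U w) = \int[P]_w \int[Q]_s h (Y w, V s))%R.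
Proof.
move=> mh hi ih.
have mhE : measurable_fun setT (EFin \o h) by exact/measurable_EFinP.
have mht t : measurable_fun setT (fun y => (h (t, y))%:E).
  by apply: (measurableT_comp mhE).
have innerE t : (\int[distribution Q pV]_y h (t, y) = \int[Q]_s h (t, V s))%R.
  by rewrite /Rintegral integral_distribution//; exact: hi.
have hi' t : (distribution Q pV).-integrable setT (fun y => (h (t, y))%:E).
  apply/integrableP; split; first exact: mht.
  rewrite ge0_integral_distribution//; last exact: measurableT_comp.
  by have /integrableP[] := hi t.
have [h1 h2] := @freezing _ _ _ _ _ _ _ P (distribution Q pV) Y U mY mU lawU indYU h mh hi' ih.
split; first by under eq_fun do rewrite -innerE.
by rewrite h2; apply: eq_Rintegral => w _; rewrite innerE.
Qed.

End freezing_rv.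

Section transfer_rv.
Context {dO d1} {Omega : measurableType dO} {T : measurableType d1} {R : realType}.
Variables (P : probability Omega R) (gam : probability T R) (X : Omega -> T).
Hypotheses (mX : measurable_fun setT X).
Hypothesis lawX : forall B, measurable B -> P (X @^-1` B) = gam B.

Let pX : {mfun Omega >-> T} := HB.pack X (isMeasurableFun.Build _ _ _ _ _ mX).

Lemma transfer_rv (h : T -> R) : gam.-integrable setT (fun y => (h y)%:E) ->
  P.-integrable setT (fun w => (h (X w))%:E) /\
  \int[P]_w h (X w) = \int[gam]_y h y.
Proof.
move=> ih; have mh : measurable_fun setT (fun y => (h y)%:E).
  exact: measurable_int ih.
have lawE (k : T -> \bar R) : (\int[distribution P pX]_y k y = \int[gam]_y k y)%E.
  by apply: eq_measure_integral => A mA _; exact: lawX.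
have ihX : P.-integrable setT (fun w => (h (X w))%:E).
  have /integrableP[_ h2] := ih; apply/integrableP; split.
    exact: measurableT_comp mh mX.
  have mA : measurable_fun setT (fun y => `|(h y)%:E|%E) by exact: measurableT_comp mh.
  have := @ge0_integral_distribution _ _ _ _ _ P pX _ mA (fun y => abse_ge0 _).
  by rewrite lawE => <-.
split => //; rewrite /Rintegral -lawE integral_distribution//.
Qed.

End transfer_rv.

Section gaussian_moments.
Context {dO} {Omega : measurableType dO} {R : realType} {d : nat}.
Variables (P : probability Omega R) (U : Omega -> 'rV[R]_d).
Hypothesis gU : standard_gaussian P U.

Lemma gaussian_coord (i : 'I_d) (h : R -> R) :
  (@std_normal R).-integrable setT (fun y => (h y)%:E) ->
  P.-integrable setT (fun w => (h (U w ord0 i))%:E) /\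
  \int[P]_w h (U w ord0 i) = \int[std_normal (R:=R)]_y h y.
Proof.
have [mU lU _] := gU; move=> ih.
exact: (@transfer_rv _ _ _ _ _ P (@std_normal R) (coordinate U i) (mU i) (lU i)).
Qed.

Lemma gaussian_coord_mean i : \int[P]_w U w ord0 i = 0.
Proof. by rewrite (gaussian_coord i (@integrable_id R)).2 std_normal_mean. Qed.

Lemma gaussian_coord_integrable_pow i n :
  P.-integrable setT (fun w => (U w ord0 i ^+ n)%:E).
Proof. exact: (gaussian_coord i (@integrable_pow R n)).1. Qed.

Lemma gaussian_coord_second i : \int[P]_w (U w ord0 i ^+ 2) = 1.
Proof. by rewrite (gaussian_coord i (@integrable_pow R 2)).2 std_normal_second_moment. Qed.

End gaussian_moments.

Section domination.
Context {R : realType} {d : nat}.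
Implicit Types x y : 'rV[R]_d.

(* Dominates every coordinate and 1, so that its fourth power dominates all
   polynomials of degree at most 4. *)
Definition onenorm1 x : R := 1 + \sum_(i < d) `|x ord0 i|.

Lemma onenorm1_ge1 x : 1 <= onenorm1 x.
Proof. by rewrite lerDl sumr_ge0. Qed.

Lemma onenorm1_ge0 x : 0 <= onenorm1 x.
Proof. exact: le_trans (onenorm1_ge1 x). Qed.

Lemma coord_le_onenorm1 x i : `|x ord0 i| <= onenorm1 x.
Proof. by rewrite /onenorm1 (bigD1 i)//= addrCA lerDl addr_ge0// sumr_ge0. Qed.

Lemma enorm_le_onenorm1 x : enorm x <= onenorm1 x.
Proof. by rewrite (le_trans (enorm_le_sum x))// lerDr. Qed.

Lemma onenorm1_pow_le x n m : (n <= m)%N -> onenorm1 x ^+ n <= onenorm1 x ^+ m.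
Proof. by move=> nm; apply: ler_weXn2l => //; exact: onenorm1_ge1. Qed.

(** Two uses of Cauchy-Schwarz leave only fourth powers of single coordinates, so integrability in
    [R^d] reduces to moments on the line. *)
Lemma onenorm1_pow4 x :
  onenorm1 x ^+ 4 <= 8 * (1 + d%:R ^+ 3 * \sum_(i < d) x ord0 i ^+ 4).
Proof.
rewrite /onenorm1; set s := \sum_(i < d) `|_|; set q := \sum_(i < d) _.
have s0 : 0 <= s by exact: sumr_ge0.
pose r := \sum_(i < d) x ord0 i ^+ 2.
have sr : s ^+ 2 <= d%:R * r.
  rewrite (le_trans (sqr_sum_le _))// ler_wpM2l ?ler0n//.
  by apply: ler_sum => i _; rewrite real_normK ?num_real.
have rq : r ^+ 2 <= d%:R * q.
  rewrite (le_trans (sqr_sum_le _))// ler_wpM2l ?ler0n//.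
  by apply: ler_sum => i _; rewrite -exprM.
have s4 : s ^+ 4 <= d%:R ^+ 3 * q.
  rewrite (exprM s 2 2) (@le_trans _ _ ((d%:R * r) ^+ 2))//.
    by rewrite lerXn2r ?nnegrE ?sqr_ge0// (le_trans _ sr)// sqr_ge0.
  by rewrite exprMn [d%:R ^+ 3]exprSr -mulrA ler_wpM2l// sqr_ge0.
have : (1 + s) ^+ 4 <= 8 * (1 + s ^+ 4).
  have h1 : (1 + s) ^+ 2 <= 2 * (1 + s ^+ 2) by have := sqr_ge0 (1 - s); nra.
  rewrite (exprM (1 + s) 2 2) (@le_trans _ _ ((2 * (1 + s ^+ 2)) ^+ 2))//.
    by rewrite lerXn2r ?nnegrE ?sqr_ge0// mulr_ge0// addr_ge0// sqr_ge0.
  by rewrite (exprM s 2 2); have := sqr_ge0 (1 - s ^+ 2); set u := s ^+ 2; nra.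
by lra.
Qed.

Lemma gaussian_integrable dO (Omega : measurableType dO) (P : probability Omega R)
    (U : Omega -> 'rV[R]_d) (phi : Omega -> R) c n : standard_gaussian P U ->
  measurable_fun setT phi -> (n <= 4)%N ->
  (forall w, `|phi w| <= c * onenorm1 (U w) ^+ n) ->
  P.-integrable setT (fun w => (phi w)%:E).
Proof.
move=> gU mphi n4 hphi.
have hphi4 w : `|phi w| <=
    `|c| * (8 * (1 + d%:R ^+ 3 * \sum_(i < d) U w ord0 i ^+ 4)).
  rewrite (le_trans (hphi w))// (@le_trans _ _ (`|c| * onenorm1 (U w) ^+ n))//.
    by rewrite ler_wpM2r ?ler_norm ?exprn_ge0 ?onenorm1_ge0.
  rewrite ler_wpM2l// (le_trans _ (onenorm1_pow4 _))//.
  exact: onenorm1_pow_le.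
apply: (integrable_leR mphi hphi4).
apply: integrableZR; apply: integrableZR; apply: integrableDR.
  exact: integrable_prob_cst.
apply: integrableZR.
by apply: integrable_sumR => i; exact: gaussian_coord_integrable_pow.
Qed.

End domination.

(** * Gaussian smoothing of a Lipschitz function *)

Section update_coordinate.
Context {R : realType} {d : nat}.
Implicit Types x : 'rV[R]_d.

Definition update x (i : 'I_d) (y : R) : 'rV[R]_d :=
  \row_j (if j == i then y else x ord0 j).

Lemma update_id x i : update x i (x ord0 i) = x.
Proof. by apply/rowP => j; rewrite mxE; case: eqP => [->|]. Qed.

Lemma update_shift x i y (a : R) :
  update x i y + a *: delta_mx ord0 i = update x i (y + a).
Proof.
apply/rowP => j; rewrite !mxE eqxx /=; case: eqP => _.
  by rewrite mulr1.
by rewrite mulr0 addr0.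
Qed.

Lemma update_coord x i y : update x i y ord0 i = y.
Proof. by rewrite mxE eqxx. Qed.

Lemma updateB x i (y z : R) : update x i y - update x i z = (y - z) *: delta_mx ord0 i.
Proof.
apply/rowP => j; rewrite !mxE eqxx /=; case: eqP => _; first by rewrite mulr1.
by rewrite mulr0 subrr.
Qed.

End update_coordinate.

Section coordinate_freezing.
Context {dS} {S : measurableType dS} {R : realType} {d : nat}.
Variables (Q : probability S R) (v : S -> 'rV[R]_d).
Hypothesis gv : standard_gaussian Q v.
Variable i : 'I_d.

Let Fam j := g_sigma_algebra_preimage (coordinate v j).
Let C : set (set S) := \bigcup_(j in [set j | j != i]) Fam j.

Let mv j : measurable_fun setT (coordinate v j). Proof. by have [] := gv. Qed.

Let FamM j : Fam j `<=` measurable.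
Proof. by move=> _ [B mB <-]; exact: mv. Qed.

Lemma coordinate_freezing (F : 'rV[R]_d -> R) :
  measurable_fun [set: rVm R d] F ->
  (forall x, (@std_normal R).-integrable setT (fun y => (F (update x i y))%:E)) ->
  Q.-integrable setT (fun s => (F (v s))%:E) ->
  Q.-integrable setT (fun s => (\int[std_normal (R:=R)]_y F (update (v s) i y))%:E) /\
  \int[Q]_s F (v s) = \int[Q]_s \int[std_normal (R:=R)]_y F (update (v s) i y).
Proof.
move=> mF iF iFv.
pose Y : S -> g_sigma_algebraType C := id.
have mY : measurable_fun setT Y.
  move=> _ A mA; rewrite setTI; apply: smallest_sub mA.
    exact: sigma_algebra_measurable.
  by move=> X [j _ /FamM].
have lawU B : measurable B -> Q (coordinate v i @^-1` B) = std_normal ((id : R -> R) @^-1` B).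
  by have [_ h _] := gv; exact: h.
have indYU A B : measurable A -> measurable B ->
    Q (Y @^-1` A `&` coordinate v i @^-1` B) =
    (Q (Y @^-1` A) * Q (coordinate v i @^-1` B))%E.
  move=> mA mB; have [_ _ ind] := gv.
  apply: (@mutually_independent_join _ _ _ Q _ Fam [set j | j != i] i) => //.
  - by move=> j; exists setT; [exact: measurableT|rewrite setTI preimage_setT].
  - move=> j _ _ [X mX <-] [X' mX' <-]; exists (X `&` X'); first exact: measurableI.
    by rewrite !setTI.
  - by rewrite /= eqxx.
  - by exists B => //; rewrite setTI.
pose h (z : g_sigma_algebraType C * R) : R := F (update (v z.1) i z.2).
have mh : measurable_fun setT h.
  (* [update] overwrites coordinate [i] with [z.2], so [z.1] enters only through coordinates
     measurable for [C]. *)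
  apply: (measurableT_comp mF); apply: measurable_fun_rV => j.
  have [->|ji] := eqVneq j i.
    by under eq_fun do rewrite update_coord; exact: measurable_snd.
  under eq_fun do rewrite mxE (negbTE ji).
  have mj : measurable_fun setT (coordinate v j : g_sigma_algebraType C -> R).
    move=> _ B mB; apply: sub_sigma_algebra; exists j => //.
    by exists B.
  exact: (measurableT_comp mj measurable_fst).
have E s : F (update (v s) i (v s ord0 i)) = F (v s) by rewrite update_id.
have := @freezing_rv _ _ _ _ _ _ _ _ R Q (@std_normal R) Y (coordinate v i) id
  mY (mv i) (@measurable_id _ _ _) lawU indYU h mh (fun t => iF (v t)).
rewrite /h /=; under eq_fun do rewrite E.
move=> /(_ iFv) [h1 h2]; split => //.
by rewrite -h2; apply: eq_Rintegral => s _; rewrite E.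
Qed.

End coordinate_freezing.

Section gaussian_lipschitz.
Context {dS} {S : measurableType dS} {R : realType} {d : nat}.
Variables (Q : probability S R) (v : S -> 'rV[R]_d).
Hypothesis gv : standard_gaussian Q v.
Variables (F : 'rV[R]_d -> R) (L : R).
Hypothesis FL : forall y z, `|F y - F z| <= L * enorm (y - z).

Lemma lipschitz_onenorm1 x : `|F x| <= (`|F 0| + `|L|) * onenorm1 x.
Proof.
rewrite -[F x](subrK (F 0)) addrC (le_trans (ler_normD _ _))// mulrDl lerD//.
  by rewrite ler_peMr// onenorm1_ge1.
rewrite (le_trans (FL _ _))// subr0.
rewrite (@le_trans _ _ (`|L| * enorm x))//.
  by rewrite ler_wpM2r ?enorm_ge0// ler_norm.
by rewrite ler_wpM2l// enorm_le_onenorm1.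
Qed.

Let mF := lipschitz_measurable FL.

Lemma measurable_lipschitz_gaussian : measurable_fun setT (fun s => F (v s)).
Proof. exact: measurableT_comp mF (gaussian_measurable gv). Qed.

Lemma integrable_lipschitz_gaussian : Q.-integrable setT (fun s => (F (v s))%:E).
Proof.
apply: (@gaussian_integrable _ _ _ _ _ v _ (`|F 0| + `|L|) 1) => //.
  exact: measurable_lipschitz_gaussian.
by move=> s; exact: lipschitz_onenorm1.
Qed.

Lemma integrable_lipschitz_coord i :
  Q.-integrable setT (fun s => (F (v s) * v s ord0 i)%:E).
Proof.
apply: (@gaussian_integrable _ _ _ _ _ v _ (`|F 0| + `|L|) 2) => //.
  apply: measurable_funM; first exact: measurable_lipschitz_gaussian.
  by have [h _ _] := gv; exact: h.
move=> s; rewrite normrM expr2 mulrA ler_pM//; first exact: lipschitz_onenorm1.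
exact: coord_le_onenorm1.
Qed.

End gaussian_lipschitz.

Section gaussian_taylor.
Context {dS} {S : measurableType dS} {R : realType} {d : nat}.
Variables (Q : probability S R) (v : S -> 'rV[R]_d).
Hypothesis gv : standard_gaussian Q v.
Variables (F : 'rV[R]_d -> R) (L : R).
Hypothesis FL : forall y z, `|F y - F z| <= L * enorm (y - z).

Lemma gaussian_taylor i (a : R) :
  `|\int[Q]_s F (v s + a *: delta_mx ord0 i) - \int[Q]_s F (v s)
    - a * \int[Q]_s (F (v s) * v s ord0 i)| <= L * taylor_const * a ^+ 2.
Proof.
pose F1 x := F (x + a *: delta_mx ord0 i).
pose F2 x := F x * x ord0 i.
have F1L y z : `|F1 y - F1 z| <= L * enorm (y - z).
  by rewrite (le_trans (FL _ _))// opprD addrACA subrr addr0.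
have mF := lipschitz_measurable FL; have mF1 := lipschitz_measurable F1L.
have mF2 : measurable_fun [set: rVm R d] F2.
  by apply: (measurable_funM mF); exact: measurable_coord.
pose g x y := F (update x i y).
have gL x y z : `|g x y - g x z| <= L * `|y - z|.
  by rewrite (le_trans (FL _ _))// updateB enorm_delta.
have L0 : 0 <= L by have [] := lipschitz_le (gL 0).
have ig x : (@std_normal R).-integrable setT (fun y => (g x y)%:E).
  have [_ h] := lipschitz_le (gL x).
  by apply: (@std_normal_integrable _ (g x) _ 1) h; exact: (lipschitz_measurable_fun (gL x)).
have ig1 x : (@std_normal R).-integrable setT (fun y => (F1 (update x i y))%:E).
  have gL' y z : `|F1 (update x i y) - F1 (update x i z)| <= L * `|y - z|.
    by rewrite (le_trans (F1L _ _))// updateB enorm_delta.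
  have [_ h] := lipschitz_le gL'.
  by apply: (@std_normal_integrable _ _ _ 1) h; exact: (lipschitz_measurable_fun gL').
have ig2 x : (@std_normal R).-integrable setT (fun y => (F2 (update x i y))%:E).
  have [_ h] := lipschitz_le (gL x).
  apply: (@std_normal_integrable _ _ (`|g x 0| + L) 2).
    apply: measurable_funM; first exact: (lipschitz_measurable_fun (gL x)).
    by under eq_fun do rewrite update_coord; exact: measurable_id.
  move=> y; rewrite /F2 update_coord normrM expr2 mulrA ler_pM//; first exact: h.
  exact: norm_le_expR.
have iF := integrable_lipschitz_gaussian gv FL.
have iF1 := integrable_lipschitz_gaussian gv F1L.
have iF2 := integrable_lipschitz_coord gv FL i.
have [j0 e0] := coordinate_freezing gv mF ig iF.
have [j1 e1] := coordinate_freezing gv mF1 ig1 iF1.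
have [j2 e2] := coordinate_freezing gv mF2 ig2 iF2.
rewrite -/(F1 _) in e1 *; rewrite e0 e1 e2.
rewrite -RintegralB// -RintegralZl// -RintegralB//; last 2 first.
- exact: integrableBR.
- exact: integrableZR.
apply: (le_trans (le_normr_Rintegral _ _)) => //.
  by apply: integrableBR; [exact: integrableBR|exact: integrableZR].
rewrite -[leRHS](Rintegral_prob_cst Q); apply: le_Rintegral => //.
- apply: integrable_norm => //.
  by apply: integrableBR; [exact: integrableBR|exact: integrableZR].
- exact: integrable_prob_cst.
move=> s _; have := std_normal_taylor a (gL (v s)).
rewrite (@eq_Rintegral _ _ _ _ _ (fun y => F1 (update (v s) i y))); last first.
  by move=> y _; rewrite /F1 update_shift.
rewrite [X in _ * X](@eq_Rintegral _ _ _ _ _ (fun y => F2 (update (v s) i y))); last first.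
  by move=> y _; rewrite /F2 update_coord.
by [].
Qed.

End gaussian_taylor.

Section smoothing.
Context {dS} {S : measurableType dS} {R : realType} {d : nat}.
Variables (Q : probability S R) (v : S -> 'rV[R]_d).
Hypothesis gv : standard_gaussian Q v.
Variables (f : 'rV[R]_d -> R) (L0 delta : R).
Hypotheses (L00 : 0 < L0) (delta0 : 0 < delta).
Hypothesis fL : forall y z, `|f y - f z| <= L0 * enorm (y - z).

Local Notation fd := (smoothed Q v f delta).
Local Notation K := (@taylor_const R).
Local Notation e_ i := (delta_mx ord0 i : 'rV[R]_d).
Implicit Types x y h : 'rV[R]_d.

(** Stein's formula for the gradient of [f_delta]; [grad_smoothed] identifies the two. *)
Definition sgrad x : 'rV[R]_d :=
  \row_i ((\int[Q]_s (f (x + delta *: v s) * v s ord0 i)) / delta).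

Lemma smoothedE x : fd x = \int[Q]_s f (x + delta *: v s).
Proof. by rewrite /smoothed unlock. Qed.

Let resc x z := f (x + delta *: z).

Let rescL x y z : `|resc x y - resc x z| <= L0 * delta * enorm (y - z).
Proof.
rewrite (le_trans (fL _ _))// opprD addrACA subrr add0r -scalerBr enormZ.
by rewrite gtr0_norm// mulrA.
Qed.

Lemma integrable_resc x : Q.-integrable setT (fun s => (f (x + delta *: v s))%:E).
Proof. exact: (integrable_lipschitz_gaussian gv (rescL x)). Qed.

Lemma integrable_resc_coord x i :
  Q.-integrable setT (fun s => (f (x + delta *: v s) * v s ord0 i)%:E).
Proof. exact: (integrable_lipschitz_coord gv (rescL x) i). Qed.

Lemma integrable_abs_coord i : Q.-integrable setT (fun s => `|v s ord0 i|%:E).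
Proof.
apply: integrable_norm => //.
exact: (gaussian_coord_integrable_pow gv i 1).
Qed.

Lemma mean_abs_coord i : \int[Q]_s `|v s ord0 i| <= 1.
Proof.
have i2 := gaussian_coord_integrable_pow gv i 2.
(* [2 |y| <= 1 + y^2], and the second moment is 1. *)
apply: (@le_trans _ _ (\int[Q]_s (2^-1 * (1 + v s ord0 i ^+ 2)))).
  apply: le_Rintegral => //; first exact: integrable_abs_coord.
    by apply: integrableZR; apply: integrableDR => //; exact: integrable_prob_cst.
  move=> s _; rewrite -[v s ord0 i ^+ 2]real_normK ?num_real//.
  by have := sqr_ge0 (1 - `|v s ord0 i|); nra.
rewrite RintegralZl//; last by apply: integrableDR => //; exact: integrable_prob_cst.
rewrite RintegralD//; last exact: integrable_prob_cst.
rewrite Rintegral_prob_cst gaussian_coord_second//; lra.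
Qed.

Lemma smoothed_lipschitz x y : `|fd x - fd y| <= L0 * enorm (x - y).
Proof.
rewrite !smoothedE -RintegralB//; try exact: integrable_resc.
apply: (le_trans (le_normr_Rintegral _ _)) => //.
  by apply: integrableBR; exact: integrable_resc.
rewrite -[leRHS](Rintegral_prob_cst Q); apply: le_Rintegral => //.
- by apply: integrable_norm => //; apply: integrableBR; exact: integrable_resc.
- exact: integrable_prob_cst.
by move=> s _; rewrite (le_trans (fL _ _))// opprD addrACA subrr addr0.
Qed.

Lemma smoothed_ge (c : R) x : (forall y, c <= f y) -> c <= fd x.
Proof.
move=> fc; rewrite smoothedE -[leLHS](Rintegral_prob_cst Q).
apply: le_Rintegral => //; first exact: integrable_prob_cst.
exact: integrable_resc.
Qed.

Lemma sgrad_lipschitz i x y :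
  `|sgrad x ord0 i - sgrad y ord0 i| <= L0 / delta * enorm (x - y).
Proof.
rewrite !mxE -mulrBl normrM [X in _ * X]gtr0_norm ?invr_gt0//.
rewrite mulrAC ler_pM2r ?invr_gt0//.
rewrite -RintegralB//; try exact: integrable_resc_coord.
apply: (le_trans (le_normr_Rintegral _ _)) => //.
  by apply: integrableBR; exact: integrable_resc_coord.
apply: (@le_trans _ _ (\int[Q]_s (L0 * enorm (x - y) * `|v s ord0 i|))).
  apply: le_Rintegral => //.
  - by apply: integrable_norm => //; apply: integrableBR; exact: integrable_resc_coord.
  - by apply: integrableZR; exact: integrable_abs_coord.
  move=> s _; rewrite -mulrBl normrM ler_wpM2r//.
  by rewrite (le_trans (fL _ _))// opprD addrACA subrr addr0.
rewrite RintegralZl//; last exact: integrable_abs_coord.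
by rewrite ler_piMr ?mean_abs_coord// mulr_ge0 ?enorm_ge0// ltW.
Qed.

Lemma smoothed_taylor_coord x i (s : R) :
  `|fd (x + s *: e_ i) - fd x - s * sgrad x ord0 i| <= L0 / delta * K * s ^+ 2.
Proof.
(* Moving [x] by [s] moves the argument of the rescaled function, whose Lipschitz constant is
   [L0 * delta], by [s / delta]. *)
have := gaussian_taylor gv (rescL x) i (s / delta).
rewrite (@eq_Rintegral _ _ _ _ _ (fun t => f (x + s *: e_ i + delta *: v t))); last first.
  move=> t _; rewrite /resc scalerDr scalerA mulrC divfK ?gt_eqF//.
  by rewrite -addrA [_ + s *: _]addrC.
rewrite -!smoothedE mxE.
rewrite (_ : L0 * delta * K * (s / delta) ^+ 2 = L0 / delta * K * s ^+ 2); last first.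
  by field; rewrite gt_eqF.
by rewrite (_ : s / delta * _ = s * (\int[Q]_s0 (f (x + delta *: v s0) * v s0 ord0 i) / delta))// mulrAC mulrA.
Qed.

(** The expansion with step [delta] has increment and error both of order [L0 * delta]. The bound
    serves as a domination in [sgrad_feedback]. *)
Lemma sgrad_bound x i : `|sgrad x ord0 i| <= L0 * (1 + K).
Proof.
have h1 := smoothed_taylor_coord x i delta.
have h2 := smoothed_lipschitz (x + delta *: e_ i) x.
rewrite addrAC subrr add0r enorm_delta (gtr0_norm delta0) in h2.
have e1 : L0 / delta * K * delta ^+ 2 = delta * (L0 * K).
  by field; rewrite gt_eqF.
rewrite e1 in h1.
have : delta * `|sgrad x ord0 i| <= delta * (L0 * (1 + K)).
  rewrite -[X in X * _ <= _](gtr0_norm delta0) -normrM.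
  rewrite (_ : delta * sgrad x ord0 i = (fd (x + delta *: e_ i) - fd x) -
    (fd (x + delta *: e_ i) - fd x - delta * sgrad x ord0 i)); last by ring.
  rewrite (le_trans (ler_normB _ _))// (le_trans (lerD h2 h1))//.
  by rewrite le_eqVlt; apply/orP; left; apply/eqP; ring.
by rewrite ler_pM2l.
Qed.

(* The first [k] coordinates of [h]; the increment [h] is travelled one
   coordinate at a time. *)
Let head h k : 'rV[R]_d := \row_j (if (j < k)%N then h ord0 j else 0).

(** A step along coordinate [i] costs its own Taylor error plus the change of [sgrad] between the
    current corner and [x], which [sgrad_lipschitz] bounds by [L0 / delta * |h|]. *)
Let smoothed_taylor_head x h k : (k <= d)%N ->
  `|fd (x + head h k) - fd x - \sum_(i < d | (i < k)%N) sgrad x ord0 i * h ord0 i|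
  <= L0 / delta * (K * \sum_(i < d | (i < k)%N) h ord0 i ^+ 2
                   + enorm h * \sum_(i < d | (i < k)%N) `|h ord0 i|).
Proof.
elim: k => [_|k IH kd].
  have -> : head h 0 = 0 by apply/rowP => j; rewrite !mxE.
  by rewrite addr0 !big_pred0// !mulr0 addr0 mulr0 subrr subr0 normr0.
have {}IH := IH (ltnW kd).
pose i := Ordinal kd.
have headS : head h k.+1 = head h k + h ord0 i *: e_ i.
  apply/rowP => j; rewrite !mxE eqxx /= ltnS leq_eqVlt.
  have -> : (j == k :> nat) = (j == i) by [].
  case: eqVneq => [->|ji] /=; first by rewrite ltnn add0r mulr1.
  by rewrite mulr0 addr0.
have sumS (a : 'I_d -> R) :
    \sum_(j < d | (j < k.+1)%N) a j = \sum_(j < d | (j < k)%N) a j + a i.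
  rewrite (bigD1 i)//= addrC; congr (_ + _); apply: eq_bigl => j.
  have -> : (j != i) = (j != k :> nat) by [].
  by rewrite ltnS ltn_neqAle andbC.
rewrite headS !sumS addrA.
have h1 := smoothed_taylor_coord (x + head h k) i (h ord0 i).
have h2 := sgrad_lipschitz i (x + head h k) x.
rewrite addrAC subrr add0r in h2.
have hk : enorm (head h k) <= enorm h.
  by apply: ler_enorm => j; rewrite mxE; case: ifP => // _; rewrite normr0.
have LD : 0 < L0 / delta by rewrite divr_gt0.
have h3 : `|h ord0 i * (sgrad (x + head h k) ord0 i - sgrad x ord0 i)| <=
    L0 / delta * (enorm h * `|h ord0 i|).
  rewrite normrM mulrC mulrA ler_wpM2r// (le_trans h2)// ler_wpM2l//; exact: ltW.
set A := \sum_(j < d | _) _ in IH *; set B := \sum_(j < d | _) _ in IH *.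
set D := \sum_(j < d | _) _ in IH *.
rewrite (_ : _ - _ - _ = (fd (x + head h k) - fd x - A)
  + (fd (x + head h k + h ord0 i *: e_ i) - fd (x + head h k)
      - h ord0 i * sgrad (x + head h k) ord0 i)
  + h ord0 i * (sgrad (x + head h k) ord0 i - sgrad x ord0 i)); last by ring.
rewrite (le_trans (ler_normD _ _))//.
apply: (le_trans (lerD (le_trans (ler_normD _ _) (lerD IH h1)) h3)).
by rewrite le_eqVlt; apply/orP; left; apply/eqP; ring.
Qed.

Lemma smoothed_quadratic x h : (0 < d)%N ->
  fd (x + h) <= fd x + \sum_(i < d) sgrad x ord0 i * h ord0 i
     + L0 / delta * (K + 1) * Num.sqrt d%:R * enorm h ^+ 2.
Proof.
move=> d0; have := smoothed_taylor_head x h (leqnn d).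
have sumT (a : 'I_d -> R) : \sum_(j < d | (j < d)%N) a j = \sum_(j < d) a j.
  by apply: eq_bigl => j; rewrite ltn_ord.
have -> : head h d = h by apply/rowP => j; rewrite mxE ltn_ord.
rewrite !sumT -sqr_enorm => /ler_normlW H.
have LD : 0 < L0 / delta by rewrite divr_gt0.
have d1 : 1 <= Num.sqrt (d%:R : R) by rewrite -[leLHS]sqrtr1; apply: ler_wsqrtr; rewrite ler1n.
have K1 := @taylor_const_ge1 R.
have h1 := sum_le_enorm h; have e0 := enorm_ge0 h.
(* The l1 norm is what produces [sqrt(d)]; the term with [K] is enlarged to match, using
   [1 <= sqrt(d)]. *)
have h2 : K * enorm h ^+ 2 + enorm h * \sum_(j < d) `|h ord0 j| <=
    (K + 1) * Num.sqrt d%:R * enorm h ^+ 2.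
  have h3 : K * enorm h ^+ 2 <= K * Num.sqrt d%:R * enorm h ^+ 2.
    rewrite ler_wpM2r ?sqr_ge0// ler_peMr//; lra.
  have h4 : enorm h * \sum_(j < d) `|h ord0 j| <= Num.sqrt d%:R * enorm h ^+ 2.
    by rewrite expr2 mulrCA ler_wpM2l.
  apply: (le_trans (lerD h3 h4)).
  by rewrite le_eqVlt; apply/orP; left; apply/eqP; ring.
have := le_trans H (ler_wpM2l (ltW LD) h2); rewrite !mulrA.
lra.
Qed.

(** [grad] is made of partial derivatives, so the one-coordinate expansion suffices: the difference
    quotient is within [M * |s|] of its limit. *)
Lemma grad_smoothed x : grad fd x = sgrad x.
Proof.
apply/rowP => i; rewrite mxE.
apply: cvg_lim => //.
apply/cvgrPdist_le => e e0.
set M := L0 / delta * K.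
have M0 : 0 <= M.
  by rewrite mulr_ge0// ?divr_ge0 ?ltW// (lt_le_trans ltr01 (@taylor_const_ge1 R)).
have eM : 0 < e / (M + 1) by rewrite divr_gt0//; lra.
have hM : \forall s \near (0 : R)^', `|s| < e / (M + 1).
  have h : (fun y : R^o => y) @ (0 : R^o)^' --> (0 : R^o).
    by apply: cvg_within; exact: cvg_id.
  move/cvgrPdist_lt: h => /(_ _ eM).
  by apply: filterS => y /=; rewrite sub0r normrN.
near=> s.
have s0 : s != 0 by near: s; exact: nbhs_dnbhs_neq.
have sM : `|s| < e / (M + 1) by near: s.
have h1 := smoothed_taylor_coord x i s.
rewrite distrC /= [s *: _ + x]addrC.
have -> : s^-1 *: (fd (x + s *: e_ i) - fd x) - sgrad x ord0 i =
  s^-1 * (fd (x + s *: e_ i) - fd x - s * sgrad x ord0 i).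
  transitivity (s^-1 * (fd (x + s *: e_ i) - fd x) - sgrad x ord0 i); first by [].
  by field.
rewrite normrM normfV mulrC ler_pdivrMr ?normr_gt0// (le_trans h1)//.
rewrite -/M -real_normK ?num_real// expr2 mulrA ler_wpM2r//.
rewrite (@le_trans _ _ ((M + 1) * `|s|))//; first by rewrite ler_wpM2r//; lra.
by rewrite mulrC -ler_pdivlMr ?ltW//; lra.
Unshelve. all: by end_near.
Qed.

Lemma smoothed_unbiased (c : R) x i :
  \int[Q]_s ((f (x + delta *: v s) - c) / delta * v s ord0 i) = sgrad x ord0 i.
Proof.
have iv := gaussian_coord_integrable_pow gv i 1.
rewrite (@eq_Rintegral _ _ _ _ _ (fun s => delta^-1 * (f (x + delta *: v s) * v s ord0 i
   - c * v s ord0 i))); last by move=> s _; ring.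
have icv : Q.-integrable setT (fun s => (c * v s ord0 i)%:E) by exact: integrableZR.
have ir := integrable_resc_coord x i.
rewrite RintegralZl//; last exact: integrableBR.
rewrite RintegralB// RintegralZl// gaussian_coord_mean// mulr0 subr0 mxE.
exact: mulrC.
Qed.

End smoothing.

Section vector_moments.
Context {dO} {Omega : measurableType dO} {R : realType} {d : nat}.
Variables (P : probability Omega R) (U : Omega -> 'rV[R]_d).
Hypothesis gU : standard_gaussian P U.

Lemma measurable_enorm_comp d1 (T : measurableType d1) (X : T -> 'rV[R]_d) :
  measurable_fun setT (X : T -> rVm R d) -> measurable_fun setT (fun t => enorm (X t)).
Proof.
move=> mX.
have ms : measurable_fun setT (fun t => \sum_(i < d) X t ord0 i ^+ 2).
  apply: measurable_sum => i; apply: measurable_funX.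
  exact: (measurableT_comp (measurable_coord i) mX).
exact: (measurableT_comp (continuous_measurable_fun (@sqrt_continuous R)) ms).
Qed.

Lemma gaussian_enorm_sqr :
  P.-integrable setT (fun w => (enorm (U w) ^+ 2)%:E) /\
  \int[P]_w (enorm (U w) ^+ 2) = d%:R.
Proof.
have h i := gaussian_coord_integrable_pow gU i 2.
split; first by under eq_fun do rewrite sqr_enorm; exact: integrable_sumR.
rewrite (@eq_Rintegral _ _ _ _ _ (fun w => \sum_(i < d) U w ord0 i ^+ 2)); last first.
  by move=> w _; rewrite sqr_enorm.
rewrite Rintegral_sum//; under eq_bigr do rewrite gaussian_coord_second//.
by rewrite sumr_const card_ord.
Qed.

(** Its value is 3, but it only enters the final constant and is left unevaluated. *)
Definition normal_moment4 : R := \int[std_normal (R:=R)]_y (y ^+ 4).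

Lemma normal_moment4_ge0 : 0 <= normal_moment4.
Proof. by apply: Rintegral_ge0 => y _; rewrite exprn_even_ge0. Qed.

Lemma gaussian_enorm_pow4 :
  P.-integrable setT (fun w => (enorm (U w) ^+ 4)%:E) /\
  \int[P]_w (enorm (U w) ^+ 4) <= normal_moment4 * d%:R ^+ 2.
Proof.
have h i := gaussian_coord_integrable_pow gU i 4.
have mU := gaussian_measurable gU.
have i4 : P.-integrable setT (fun w => (enorm (U w) ^+ 4)%:E).
  apply: (@gaussian_integrable _ _ _ _ P U _ 1 4 gU) => //.
    by apply: measurable_funX; exact: measurable_enorm_comp.
  move=> w; rewrite mul1r ger0_norm ?exprn_ge0 ?enorm_ge0//.
  by rewrite lerXn2r ?nnegrE ?enorm_ge0 ?onenorm1_ge0 ?enorm_le_onenorm1.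
split=> //.
apply: (@le_trans _ _ (\int[P]_w (d%:R * \sum_(i < d) U w ord0 i ^+ 4))).
  apply: le_Rintegral => //; first by apply: integrableZR; exact: integrable_sumR.
  move=> w _; rewrite (exprM _ 2 2) sqr_enorm (le_trans (sqr_sum_le _))//.
  rewrite ler_wpM2l ?ler0n//; apply: ler_sum => i _.
  by rewrite -exprM.
rewrite RintegralZl//; last exact: integrable_sumR.
rewrite Rintegral_sum//.
under eq_bigr do rewrite (gaussian_coord gU _ (@integrable_pow R 4)).2.
rewrite sumr_const card_ord -/normal_moment4 -[X in _ * X <= _]mulr_natl.
by rewrite mulrA mulrC expr2.
Qed.

End vector_moments.

(** * The residual-feedback iteration *)

Section process.
Context {R : realType} {d : nat}.
Variables (f : 'rV[R]_d -> R) (L0 eta delta : R) (x0 : 'rV[R]_d).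
Context {dO} {Omega : measurableType dO}.
Variables (P : probability Omega R) (u x : nat -> Omega -> 'rV[R]_d).
Context {dS} {S : measurableType dS}.
Variables (Q : probability S R) (v : S -> 'rV[R]_d).
Hypotheses (d_gt0 : (0 < d)%N) (L0_gt0 : 0 < L0) (delta_gt0 : 0 < delta).
Hypothesis eta_ge0 : 0 <= eta.
Hypothesis fL : forall y z, `|f y - f z| <= L0 * enorm (y - z).
Hypothesis uG : iid_standard_gaussian P u.
Hypothesis xx0 : forall w, x 0%N w = x0.
Hypothesis xS : forall t w, x t.+1 w =
  x t w - eta *: residual_feedback f delta (u ^~ w) (x ^~ w) t.
Hypothesis gv : standard_gaussian Q v.

Local Notation fd := (smoothed Q v f delta).
Local Notation G := (sgrad Q v f delta).

(** Generates the filtration just before time [t]. Retyping [Omega] as [Om t] turns adaptedness of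
    [x t] and [prev t] into plain measurability. *)
Definition past (t : nat) : set (set Omega) :=
  \bigcup_(s in [set s | (s < t)%N]) sigma_vector (u s).
Local Notation Om t := (g_sigma_algebraType (past t)).

(* The value subtracted at time [t]; it is 0 at time 0, which makes the two cases
   of [residual_feedback] uniform. *)
Definition prev (t : nat) (w : Omega) : R :=
  if t is s.+1 then f (x s w + delta *: u s w) else 0.

(** The current perturbation is a separate argument [y], so that it can be integrated out while the
    past [w] stays frozen. *)
Definition feedback (t : nat) (w : Omega) (y : 'rV[R]_d) : 'rV[R]_d :=
  ((f (x t w + delta *: y) - prev t w) / delta) *: y.

Lemma residual_feedbackE t w :
  residual_feedback f delta (u ^~ w) (x ^~ w) t = feedback t w (u t w).
Proof. by case: t => [|t] //=; rewrite /feedback /prev subr0. Qed.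

Let gU t : standard_gaussian P (u t). Proof. exact: uG.1. Qed.

Let mu_coord t i : measurable_fun setT (coordinate (u t) i).
Proof. by have [h _ _] := gU t; exact: h. Qed.

Lemma past_measurable t : <<s past t >> `<=` measurable.
Proof.
apply: smallest_sub; first exact: sigma_algebra_measurable.
by move=> A [s _]; apply: sigma_vector_measurable.
Qed.

Lemma measurable_past_id t : measurable_fun setT (id : Omega -> Om t).
Proof. by move=> _ A mA; rewrite setTI; exact: (@past_measurable t A mA). Qed.

Lemma measurable_pastS t : measurable_fun setT (id : Om t.+1 -> Om t).
Proof.
move=> _ A mA; rewrite setTI; apply: sub_sigma_algebra2 mA => B [s /= st sB].
by exists s => //=; exact: ltnW.
Qed.

Lemma measurable_past_u t : measurable_fun setT (u t : Om t.+1 -> rVm R d).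
Proof.
move=> _ B mB; rewrite setTI; apply: sub_sigma_algebra; exists t => //=.
exact: sigma_vector_preimage.
Qed.

Lemma measurable_affine d1 (T : measurableType d1) (X Y : T -> 'rV[R]_d) (c : T -> R) :
  measurable_fun setT (X : T -> rVm R d) -> measurable_fun setT (Y : T -> rVm R d) ->
  measurable_fun setT c ->
  measurable_fun setT ((fun t => X t + c t *: Y t) : T -> rVm R d).
Proof.
move=> mX mY mc; apply: measurable_fun_rV => i.
under eq_fun do rewrite !mxE.
apply: measurable_funD; first exact: (measurableT_comp (measurable_coord i) mX).
by apply: measurable_funM => //; exact: (measurableT_comp (measurable_coord i) mY).
Qed.

Let mf := lipschitz_measurable fL.

Lemma measurable_iterate t : measurable_fun setT (x t : Om t -> rVm R d) /\
  measurable_fun setT (prev t : Om t -> R).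
Proof.
elim: t => [|t [mx mp]].
  split; last exact: measurable_cst.
  have -> : x 0%N = (fun=> x0) by apply/funext => w; rewrite xx0.
  exact: (@measurable_cst _ _ (Om 0) (rVm R d) setT x0).
have mx' : measurable_fun setT (x t : Om t.+1 -> rVm R d).
  exact: (measurableT_comp mx (@measurable_pastS t)).
have mp' : measurable_fun setT (prev t : Om t.+1 -> R).
  exact: (measurableT_comp mp (@measurable_pastS t)).
have mfx : measurable_fun setT (fun w : Om t.+1 => f (x t w + delta *: u t w)).
  apply: (measurableT_comp mf).
  by apply: measurable_affine => //; exact: measurable_past_u.
split; last by [].
have -> : x t.+1 = fun w =>
    x t w + (- eta * ((f (x t w + delta *: u t w) - prev t w) / delta)) *: u t w.
  by apply/funext => w; rewrite xS residual_feedbackE /feedback scalerA mulNr scaleNr.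
apply: measurable_affine => //; first exact: measurable_past_u.
apply: measurable_funM => //; apply: measurable_funM => //.
exact: measurable_funB.
Qed.

Lemma measurable_feedback_scal t : measurable_fun setT
  (fun z : Om t * rVm R d => (f (x t z.1 + delta *: z.2) - prev t z.1) / delta).
Proof.
have [mx mp] := measurable_iterate t.
apply: measurable_funM => //; apply: measurable_funB; last first.
  exact: (measurableT_comp mp measurable_fst).
apply: (measurableT_comp mf); apply: measurable_affine => //.
  exact: (measurableT_comp mx measurable_fst).
Qed.

Lemma measurable_feedback t : measurable_fun setT
  ((fun z : Om t * rVm R d => feedback t z.1 z.2) : Om t * rVm R d -> rVm R d).
Proof.
apply: measurable_fun_rV => i; rewrite /feedback.
under eq_fun do rewrite mxE.
apply: measurable_funM; first exact: measurable_feedback_scal.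
exact: (measurableT_comp (measurable_coord i) measurable_snd).
Qed.

Lemma past_independent t (A : set (Om t)) (B : set (rVm R d)) :
  measurable A -> measurable B ->
  P ((id : Omega -> Om t) @^-1` A `&` u t @^-1` B) =
  (P ((id : Omega -> Om t) @^-1` A) * P (u t @^-1` B))%E.
Proof.
move=> mA mB.
apply: (@mutually_independent_join _ _ _ P _ (fun s => sigma_vector (u s))
  [set s | (s < t)%N] t) => //.
- by move=> s; apply: sigma_vector_measurable.
- by move=> s; exact: sigma_vectorT.
- by move=> s; exact: sigma_vector_setI.
- exact: uG.2.
- by rewrite /= ltnn.
- exact: sigma_vector_preimage.
Qed.

Let mv := gaussian_measurable gv.
Let muV t := gaussian_measurable (gU t).
Let lawu t (B : set (rVm R d)) (mB : measurable B) := gaussian_law (gU t) gv mB.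

Lemma ge0_past_freezing t (h : Om t * rVm R d -> \bar R) :
  measurable_fun setT h -> (forall z, 0 <= h z)%E ->
  (\int[P]_w h (w, u t w) = \int[P]_w \int[Q]_s h (w, v s))%E.
Proof.
exact: (@ge0_freezing_rv _ _ _ _ _ _ (Om t) (rVm R d) _ P Q (id : Omega -> Om t) (u t) v
  (@measurable_past_id t) (muV t) mv (lawu t) (@past_independent t) h).
Qed.

Lemma past_freezing t (h : Om t * rVm R d -> R) :
  measurable_fun setT h -> (forall w, Q.-integrable setT (fun s => (h (w, v s))%:E)) ->
  P.-integrable setT (fun w => (h (w, u t w))%:E) ->
  P.-integrable setT (fun w => (\int[Q]_s h (w, v s))%:E) /\
  \int[P]_w h (w, u t w) = \int[P]_w \int[Q]_s h (w, v s).
Proof.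
exact: (@freezing_rv _ _ _ _ _ _ (Om t) (rVm R d) _ P Q (id : Omega -> Om t) (u t) v
  (@measurable_past_id t) (muV t) mv (lawu t) (@past_independent t) h).
Qed.

Definition sqr_feedback t (w : Omega) : R := enorm (feedback t w (u t w)) ^+ 2.

Lemma sqr_feedback_ge0 t w : 0 <= sqr_feedback t w. Proof. exact: sqr_ge0. Qed.

Lemma measurable_feedback_u t :
  measurable_fun setT ((fun w => feedback t w (u t w)) : Om t.+1 -> rVm R d).
Proof.
have mp : measurable_fun setT ((fun w => (w, u t w)) : Om t.+1 -> Om t * rVm R d).
  by apply: measurable_fun_pair; [exact: measurable_pastS|exact: measurable_past_u].
exact: (measurableT_comp (@measurable_feedback t) mp).
Qed.

Lemma measurable_sqr_feedback t : measurable_fun setT (sqr_feedback t : Om t.+1 -> R).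
Proof. by apply: measurable_funX; apply: measurable_enorm_comp; exact: measurable_feedback_u. Qed.

Lemma measurable_sqr_feedback_Omega t : measurable_fun setT (sqr_feedback t).
Proof. exact: (measurableT_comp (@measurable_sqr_feedback t) (@measurable_past_id t.+1)). Qed.

Lemma sqr_feedback_step t w : sqr_feedback t.+1 w <=
  2 * (L0 * eta / delta) ^+ 2 * (sqr_feedback t w * enorm (u t.+1 w) ^+ 2)
  + (6 * L0 ^+ 2 * enorm (u t.+1 w) ^+ 4 + 2 * L0 ^+ 2 * enorm (u t w) ^+ 4).
Proof.
rewrite /sqr_feedback {1}/feedback /prev enormZ exprMn real_normK ?num_real//.
set U := u t.+1 w; set U0 := u t w; set r := feedback t w U0.
set D := f _ - f _.
(* The two query points differ by [- eta r + delta (U - U0)]. *)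
have hD : D ^+ 2 <= L0 ^+ 2 * (2 * (eta ^+ 2 * enorm r ^+ 2)
    + 2 * (delta ^+ 2 * (2 * enorm U ^+ 2 + 2 * enorm U0 ^+ 2))).
  rewrite -real_normK ?num_real// (@le_trans _ _ ((L0 * enorm
     ((- eta) *: r + delta *: (U - U0))) ^+ 2))//.
    rewrite lerXn2r ?nnegrE ?mulr_ge0 ?enorm_ge0 ?(ltW L0_gt0)//.
    rewrite (le_trans (fL _ _))// ler_wpM2l ?(ltW L0_gt0)// /r xS residual_feedbackE -/U0.
    rewrite le_eqVlt; apply/orP; left; apply/eqP; congr enorm.
    rewrite scalerBr scaleNr.
    by apply/rowP => i; rewrite !mxE; ring.
  rewrite exprMn ler_wpM2l ?sqr_ge0// (le_trans (sqr_enormD_le _ _))//.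
  rewrite !enormZ !exprMn !real_normK ?num_real// sqrrN lerD2l.
  rewrite ler_wpM2l// ler_wpM2l ?sqr_ge0//.
  by rewrite (le_trans (sqr_enormD_le _ _))// -[- U0]scaleN1r enormZ normrN1 mul1r.
have dl : delta != 0 by rewrite gt_eqF.
rewrite exprMn exprVn.
set a := enorm U ^+ 2; set b := enorm U0 ^+ 2; set s := enorm r ^+ 2 in hD *.
have a0 : 0 <= a by exact: sqr_ge0.
have b0 : 0 <= b by exact: sqr_ge0.
rewrite (exprM _ 2 2) (exprM (enorm U0) 2 2) -/a -/b.
have di : 0 <= (delta ^+ 2)^-1 by rewrite invr_ge0 sqr_ge0.
have := ler_wpM2r a0 (ler_wpM2r di hD).
move=> /le_trans; apply.
have -> : L0 ^+ 2 * (2 * (eta ^+ 2 * s) + 2 * (delta ^+ 2 * (2 * a + 2 * b))) / delta ^+ 2 * a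
   = 2 * (L0 * eta / delta) ^+ 2 * (s * a) + (4 * L0 ^+ 2 * a ^+ 2 + L0 ^+ 2 * (4 * (a * b))).
  by field.
rewrite lerD2l.
(* Splitting the mixed term leaves pure fourth powers: 4 + 2 = 6 for the new perturbation and 2 for
   the old one. *)
have ab : 4 * (a * b) <= 2 * a ^+ 2 + 2 * b ^+ 2 by have := sqr_ge0 (a - b); nra.
have := ler_wpM2l (sqr_ge0 L0) ab; lra.
Qed.

(** The start is deterministic and [f] grows linearly, so the squared feedback has growth of degree
    four in [u 0]. *)
Lemma integrable_sqr_feedback0 : P.-integrable setT (fun w => (sqr_feedback 0 w)%:E).
Proof.
have rL y z : `|f (x0 + delta *: y) - f (x0 + delta *: z)| <= L0 * delta * enorm (y - z).
  rewrite (le_trans (fL _ _))// opprD addrACA subrr add0r -scalerBr enormZ.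
  by rewrite (gtr0_norm delta_gt0) mulrA.
pose c := `|f (x0 + delta *: 0)| + `|L0 * delta|.
apply: (@gaussian_integrable _ _ _ _ P (u 0%N) _ ((c / delta) ^+ 2) 4 (gU 0)) => //.
  exact: measurable_sqr_feedback_Omega.
move=> w; rewrite ger0_norm ?sqr_feedback_ge0// /sqr_feedback /feedback /prev subr0 xx0 enormZ exprMn.
rewrite (_ : _ * onenorm1 _ ^+ 4 = (c * onenorm1 (u 0%N w) / delta) ^+ 2 * onenorm1 (u 0%N w) ^+ 2); last by field; rewrite gt_eqF.
have c0 : 0 <= c by rewrite addr_ge0.
rewrite ler_pM ?sqr_ge0//; last first.
  by rewrite lerXn2r ?nnegrE ?enorm_ge0 ?onenorm1_ge0 ?enorm_le_onenorm1.
rewrite lerXn2r ?nnegrE ?divr_ge0 ?mulr_ge0 ?onenorm1_ge0// ?(ltW delta_gt0)//.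
have di : 0 < delta^-1 by rewrite invr_gt0.
rewrite normrM (gtr0_norm di) ler_pM2r//.
exact: (lipschitz_onenorm1 rL).
Qed.

(** The feedback at time [t] belongs to the past of [t.+1], so the product factorizes. Integrability
    comes first, from the nonnegative form of freezing; the value follows from the real-valued
    form. *)
Lemma integrable_sqr_feedback_step t : P.-integrable setT (fun w => (sqr_feedback t w)%:E) ->
  P.-integrable setT (fun w => (sqr_feedback t w * enorm (u t.+1 w) ^+ 2)%:E) /\
  \int[P]_w (sqr_feedback t w * enorm (u t.+1 w) ^+ 2) = d%:R * \int[P]_w sqr_feedback t w.
Proof.
move=> ih.
pose h (z : Om t.+1 * rVm R d) : R := sqr_feedback t z.1 * enorm (z.2 : 'rV[R]_d) ^+ 2.
have mh : measurable_fun setT h.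
  apply: measurable_funM; first exact: (measurableT_comp (@measurable_sqr_feedback t) measurable_fst).
  by apply: measurable_funX; apply: measurable_enorm_comp; exact: measurable_snd.
have h0 z : 0 <= h z by rewrite mulr_ge0 ?sqr_ge0.
have [iv ev] := gaussian_enorm_sqr gv.
have inner w : \int[Q]_s h (w, v s) = sqr_feedback t w * d%:R by rewrite /h /= RintegralZl// ev.
have ihw w : Q.-integrable setT (fun s => (h (w, v s))%:E).
  exact: (integrableZR (sqr_feedback t w) iv).
have innerE w : (\int[Q]_s (h (w, v s))%:E = (d%:R * sqr_feedback t w)%:E)%E.
  rewrite mulrC -inner /Rintegral fineK//; apply: integrable_fin_num => //; exact: ihw.
have mhu : measurable_fun setT (fun w => h (w, u t.+1 w)).
  apply: (measurableT_comp mh); apply: measurable_fun_pair; [exact: measurable_past_id|exact: muV].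
have ihu : P.-integrable setT (fun w => (h (w, u t.+1 w))%:E).
  apply/integrableP; split; first exact/measurable_EFinP.
  under eq_integral do rewrite gee0_abs ?lee_fin//.
  rewrite (@ge0_past_freezing t.+1 (EFin \o h)) /=; last 2 first.
  - exact/measurable_EFinP.
  - by move=> z; rewrite lee_fin.
  under eq_integral do rewrite innerE.
  have /integrableP[_] := integrableZR d%:R ih.
  have e w : (`|(d%:R * sqr_feedback t w)%:E| = (d%:R * sqr_feedback t w)%:E)%E.
    by rewrite gee0_abs// lee_fin mulr_ge0// sqr_feedback_ge0.
  by under eq_integral do rewrite e.
split => //.
rewrite (@past_freezing t.+1 h mh _ ihu).2; last exact: ihw.
under eq_Rintegral do rewrite inner.
by rewrite RintegralZr// mulrC.
Qed.

Lemma integrable_sqr_feedback t : P.-integrable setT (fun w => (sqr_feedback t w)%:E).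
Proof.
elim: t => [|t IH]; first exact: integrable_sqr_feedback0.
have [i1 _] := integrable_sqr_feedback_step IH.
have [j1 _] := gaussian_enorm_pow4 (gU t.+1); have [j0 _] := gaussian_enorm_pow4 (gU t).
have k1 := integrableZR (2 * (L0 * eta / delta) ^+ 2) i1.
have k2 := integrableZR (6 * L0 ^+ 2) j1.
have k3 := integrableZR (2 * L0 ^+ 2) j0.
apply: (integrable_leR (@measurable_sqr_feedback_Omega t.+1) _ (integrableDR k1 (integrableDR k2 k3))).
by move=> w; rewrite ger0_norm ?sqr_feedback_ge0//; exact: sqr_feedback_step.
Qed.

Definition second_moment t : R := \int[P]_w sqr_feedback t w.

Lemma second_moment_ge0 t : 0 <= second_moment t.
Proof. by apply: Rintegral_ge0 => w _; exact: sqr_feedback_ge0. Qed.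

Lemma second_moment_step t : second_moment t.+1 <= 2 * (L0 * eta / delta) ^+ 2 * d%:R * second_moment t
  + 8 * L0 ^+ 2 * normal_moment4 (R:=R) * d%:R ^+ 2.
Proof.
have [i1 e1] := integrable_sqr_feedback_step (integrable_sqr_feedback t).
have [j1 l1] := gaussian_enorm_pow4 (gU t.+1).
have [j0 l0] := gaussian_enorm_pow4 (gU t).
have k1 : P.-integrable setT (fun w => (2 * (L0 * eta / delta) ^+ 2 * (sqr_feedback t w * enorm (u t.+1 w) ^+ 2))%:E) by exact: integrableZR.
have k2 : P.-integrable setT (fun w => (6 * L0 ^+ 2 * enorm (u t.+1 w) ^+ 4)%:E) by exact: integrableZR.
have k3 : P.-integrable setT (fun w => (2 * L0 ^+ 2 * enorm (u t w) ^+ 4)%:E) by exact: integrableZR.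
have := @le_Rintegral _ _ _ P setT _ _ measurableT (integrable_sqr_feedback t.+1)
  (integrableDR k1 (integrableDR k2 k3)) (fun w _ => sqr_feedback_step t w).
rewrite RintegralD//; last exact: integrableDR.
rewrite RintegralD// !RintegralZl// e1 => h.
apply: (le_trans h); rewrite -!mulrA lerD2l.
have L2 := sqr_ge0 L0.
have h1 := ler_wpM2l L2 l1; have h0 := ler_wpM2l L2 l0.
lra.
Qed.

Lemma measurable_sgrad_iterate t i :
  measurable_fun setT ((fun w => G (x t w) ord0 i) : Om t -> R).
Proof.
have [mx _] := measurable_iterate t.
have mG := lipschitz_measurable (sgrad_lipschitz gv L0_gt0 delta_gt0 fL i).
exact: (measurableT_comp mG mx).
Qed.

Lemma le_1Dsqr (a : R) : a <= 1 + a ^+ 2.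
Proof. have := sqr_ge0 (1 - a); have := sqr_ge0 a; nra. Qed.

Lemma sgrad_feedback t i :
  [/\ P.-integrable setT (fun w => (G (x t w) ord0 i * feedback t w (u t w) ord0 i)%:E),
      P.-integrable setT (fun w => (G (x t w) ord0 i ^+ 2)%:E) &
      \int[P]_w (G (x t w) ord0 i * feedback t w (u t w) ord0 i) =
      \int[P]_w (G (x t w) ord0 i ^+ 2)].
Proof.
pose h (z : Om t * rVm R d) : R := G (x t z.1) ord0 i * feedback t z.1 z.2 ord0 i.
have mh : measurable_fun setT h.
  apply: measurable_funM.
    exact: (measurableT_comp (@measurable_sgrad_iterate t i) measurable_fst).
  exact: (measurableT_comp (measurable_coord i) (@measurable_feedback t)).
have hE w s : h (w, v s) = G (x t w) ord0 i *
    ((f (x t w + delta *: v s) - prev t w) / delta * v s ord0 i).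
  by rewrite /h /feedback /= [X in _ * X = _]mxE.
have i0 w : Q.-integrable setT
    (fun s => ((f (x t w + delta *: v s) - prev t w) / delta * v s ord0 i)%:E).
  have k1 := integrable_resc_coord gv delta_gt0 fL (x t w) i.
  have k2 := integrableZR (prev t w) (gaussian_coord_integrable_pow gv i 1).
  have := integrableZR delta^-1 (integrableBR k1 k2).
  by apply: eq_integrable => // s _; congr EFin; rewrite expr1; ring.
have ih w : Q.-integrable setT (fun s => (h (w, v s))%:E).
  by under eq_fun do rewrite hE; exact: integrableZR (i0 w).
have inner w : \int[Q]_s h (w, v s) = G (x t w) ord0 i ^+ 2.
  under eq_Rintegral do rewrite hE.
  by rewrite (RintegralZl _ measurableT (i0 w)) (smoothed_unbiased gv delta_gt0 fL) expr2.
have mhu : measurable_fun setT (fun w => h (w, u t w)).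
  apply: (measurableT_comp mh); apply: measurable_fun_pair; [exact: measurable_past_id|exact: muV].
have ihu : P.-integrable setT (fun w => (h (w, u t w))%:E).
  have k1 := integrableZR (L0 * (1 + taylor_const (R:=R)))
    (integrableDR (integrable_prob_cst P 1) (integrable_sqr_feedback t)).
  apply: (integrable_leR mhu _ k1) => w.
  rewrite normrM ler_pM//; first exact: sgrad_bound.
  by rewrite (le_trans (enorm_coord _ _))//; exact: le_1Dsqr.
have [k1 k2] := past_freezing mh ih ihu.
split; first exact: ihu.
- by under eq_fun do rewrite -inner.
- by rewrite [LHS]k2; under eq_Rintegral do rewrite inner.
Qed.

Definition sqr_sgrad_mean t : R := \int[P]_w (enorm (G (x t w)) ^+ 2).

Lemma integrable_sqr_sgrad t : P.-integrable setT (fun w => (enorm (G (x t w)) ^+ 2)%:E).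
Proof.
under eq_fun do rewrite sqr_enorm.
by apply: integrable_sumR => i; have [] := sgrad_feedback t i.
Qed.

Lemma measurable_smoothed_iterate t : measurable_fun setT (fun w => fd (x t w)).
Proof.
have [mx _] := measurable_iterate t.
have mfd := lipschitz_measurable (smoothed_lipschitz gv delta_gt0 fL).
exact: (measurableT_comp mfd (measurableT_comp mx (@measurable_past_id t))).
Qed.

Lemma integrable_smoothed_iterate t : P.-integrable setT (fun w => (fd (x t w))%:E).
Proof.
elim: t => [|t IH].
  by under eq_fun do rewrite xx0; exact: integrable_prob_cst.
have k1 := integrableDR (integrable_norm IH)
  (integrableZR (L0 * eta) (integrableDR (integrable_prob_cst P 1) (integrable_sqr_feedback t))).
apply: (integrable_leR (measurable_smoothed_iterate t.+1) _ k1) => w /=.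
rewrite -[fd (x t.+1 w)](subrK (fd (x t w))) addrC (le_trans (ler_normD _ _))// lerD2l.
rewrite (le_trans (smoothed_lipschitz gv delta_gt0 fL _ _))//.
rewrite xS residual_feedbackE addrAC subrr add0r -scaleNr enormZ normrN (ger0_norm eta_ge0).
rewrite -mulrA ler_wpM2l ?(ltW L0_gt0)// ler_wpM2l//; exact: le_1Dsqr.
Qed.

Lemma descent t :
  \int[P]_w fd (x t.+1 w) <= \int[P]_w fd (x t w) - eta * sqr_sgrad_mean t
    + L0 / delta * (taylor_const (R:=R) + 1) * Num.sqrt d%:R * eta ^+ 2 * second_moment t.
Proof.
set K' := L0 / delta * _ * _.
pose ip w := \sum_(i < d) G (x t w) ord0 i * feedback t w (u t w) ord0 i.
have iip : P.-integrable setT (fun w => (ip w)%:E).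
  by apply: integrable_sumR => i; have [] := sgrad_feedback t i.
have Eip : \int[P]_w ip w = sqr_sgrad_mean t.
  rewrite Rintegral_sum; last by move=> i; have [] := sgrad_feedback t i.
  transitivity (\sum_(i < d) \int[P]_w (G (x t w) ord0 i ^+ 2)).
    by apply: eq_bigr => i _; have [] := sgrad_feedback t i.
  rewrite -Rintegral_sum; last by move=> i; have [] := sgrad_feedback t i.
  by apply: eq_Rintegral => w _; rewrite sqr_enorm.
have pw w : fd (x t.+1 w) <= fd (x t w) - eta * ip w + K' * eta ^+ 2 * sqr_feedback t w.
  rewrite xS residual_feedbackE.
  have := smoothed_quadratic gv L0_gt0 delta_gt0 fL (x t w) (- (eta *: feedback t w (u t w))) d_gt0.
  rewrite -/K' -scaleNr enormZ exprMn real_normK ?num_real// sqrrN mulrA.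
  rewrite (_ : \sum_(i < d) _ = - eta * ip w); first by rewrite mulNr.
  by rewrite /ip mulr_sumr; apply: eq_bigr => i _; rewrite !mxE; ring.
have j1 := integrable_smoothed_iterate t.
have j2 := integrableZR eta iip.
have j3 := integrableZR (K' * eta ^+ 2) (integrable_sqr_feedback t).
have := @le_Rintegral _ _ _ P setT _ _ measurableT (integrable_smoothed_iterate t.+1)
  (integrableDR (integrableBR j1 j2) j3) (fun w _ => pw w).
rewrite RintegralD//; last exact: integrableBR.
by rewrite RintegralB// !RintegralZl//; [rewrite Eip|exact: integrable_sqr_feedback].
Qed.

Lemma sum_second_moment_le n : 2 * (L0 * eta / delta) ^+ 2 * d%:R <= 1 / 2 ->
  \sum_(t < n) second_moment t <=
  2 * second_moment 0 + 16 * L0 ^+ 2 * normal_moment4 (R:=R) * d%:R ^+ 2 * n%:R.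
Proof.
move=> al; set B := 16 * _ * _ * _.
have st t : 2 * second_moment t.+1 <= second_moment t + B.
  have := second_moment_step t; have := ler_wpM2r (second_moment_ge0 t) al; rewrite /B; lra.
(* The extra term [- 2 * second_moment n] closes the induction: the next summand turns it into
   [- second_moment n], which [st] bounds by [B - 2 * second_moment n.+1]. *)
suff : \sum_(t < n) second_moment t <= 2 * second_moment 0 + B * n%:R - 2 * second_moment n by have := second_moment_ge0 n; lra.
elim: n => [|n IH]; first by rewrite big_ord0 mulr0 addr0 subrr.
rewrite big_ord_recr/= -natr1; have := st n; lra.
Qed.

Lemma sum_sqr_sgrad_mean_le n (m : R) : 2 * (L0 * eta / delta) ^+ 2 * d%:R <= 1 / 2 ->
  (forall y, m <= fd y) ->
  eta * \sum_(t < n) sqr_sgrad_mean t <= fd x0 - m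
    + L0 / delta * (taylor_const (R:=R) + 1) * Num.sqrt d%:R * eta ^+ 2 *
      (2 * second_moment 0 + 16 * L0 ^+ 2 * normal_moment4 (R:=R) * d%:R ^+ 2 * n%:R).
Proof.
move=> al fdm; set K' := L0 / delta * _ * _.
have K'0 : 0 <= K' * eta ^+ 2.
  have := @taylor_const_ge1 R => K1.
  by rewrite !mulr_ge0 ?sqr_ge0 ?sqrtr_ge0 ?invr_ge0 ?(ltW L0_gt0) ?(ltW delta_gt0)//; lra.
have e0 : \int[P]_w fd (x 0%N w) = fd x0.
  by under eq_Rintegral do rewrite xx0; rewrite Rintegral_prob_cst.
have em : m <= \int[P]_w fd (x n w).
  rewrite -[leLHS](Rintegral_prob_cst P); apply: le_Rintegral => //.
    exact: integrable_prob_cst.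
  exact: integrable_smoothed_iterate.
have tele : eta * \sum_(t < n) sqr_sgrad_mean t <= fd x0 - \int[P]_w fd (x n w)
    + K' * eta ^+ 2 * \sum_(t < n) second_moment t.
  elim: n {em} => [|n IH]; first by rewrite !big_ord0 !mulr0 addr0 e0 subrr.
  rewrite !big_ord_recr/= !mulrDr; have := descent n; rewrite -/K'; lra.
have := ler_wpM2l K'0 (sum_second_moment_le n al); lra.
Qed.

End process.

(** * Uniform random choice of the iterate *)

Section uniform_sampling.
Context {dO} {Omega : measurableType dO} {R : realType}.
Variables (P : probability Omega R) (C : set (set Omega)).
Local Notation OmC := (g_sigma_algebraType C).
Variables (tau : {RV P >-> nat}) (T : nat) (phi : nat -> Omega -> R).
Hypotheses (Cm : <<s C >> `<=` measurable) (T_gt0 : (0 < T)%N).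
Hypothesis unif : uniform_index T tau.
Hypothesis ind : independent P (g_sigma_algebra_preimage tau) <<s C >>.
Hypothesis mphi : forall k, measurable_fun setT (phi k : OmC -> R).
Hypothesis phi0 : forall k w, 0 <= phi k w.
Hypothesis iphi : forall k, P.-integrable setT (fun w => (phi k w)%:E).

Let A k : set Omega := tau @^-1` [set k].

Let mA k : measurable (A k).
Proof. by rewrite -[X in measurable X]setTI; apply: measurable_funP. Qed.

Let mid : measurable_fun setT (id : Omega -> OmC).
Proof. by move=> _ B mB; rewrite setTI; exact: (Cm mB). Qed.

Let mphiO k : measurable_fun setT (phi k).
Proof. exact: (measurableT_comp (mphi k) mid). Qed.

Let sampled (k : nat) : (k < T)%N ->
  P.-integrable setT (fun w => (phi k w * \1_(A k) w)%:E) /\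
  \int[P]_w (phi k w * \1_(A k) w) = T%:R^-1 * \int[P]_w phi k w.
Proof.
move=> kT.
have intA : P.-integrable setT (fun w => (\1_(A k) w)%:E).
  exact: integrable_indic.
have ihu : P.-integrable setT (fun w => (phi k w * \1_(A k) w)%:E).
  apply: (integrable_leR _ _ (iphi k)).
    by apply: measurable_funM => //; exact: measurable_indic.
  move=> w; rewrite normrM ger0_norm// ger0_norm// indicE.
  by case: (_ \in _); rewrite ?mulr1 ?mulr0.
split=> //.
pose h (z : OmC * nat) : R := phi k z.1 * \1_[set k] z.2.
have mh : measurable_fun setT h.
  apply: measurable_funM; first exact: (measurableT_comp (mphi k) measurable_fst).
  have m1 : measurable_fun setT (\1_[set k] : nat -> R) by exact: measurable_indic.
  exact: (measurableT_comp m1 measurable_snd).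
have E w s : h (w, tau s) = phi k w * \1_(A k) s by [].
have indP B D : measurable B -> measurable D ->
    P ((id : Omega -> OmC) @^-1` B `&` tau @^-1` D) =
    (P ((id : Omega -> OmC) @^-1` B) * P (tau @^-1` D))%E.
  move=> mB mD; rewrite setIC ind//; first exact: muleC.
  by exists D => //; rewrite setTI.
have ih w : P.-integrable setT (fun s => (h (w, tau s))%:E).
  by under eq_fun do rewrite E; exact: integrableZR.
(* Here [tau] is the variable integrated out, and it also represents its own law. *)
have := @freezing_rv _ _ _ _ _ _ OmC nat _ P P (id : Omega -> OmC) tau tau mid
  (measurable_funPT tau) (measurable_funPT tau) (fun _ _ => erefl) indP h mh ih ihu.
move=> [_]; under eq_Rintegral do rewrite E.
move=> ->.
have PA : \int[P]_s \1_(A k) s = T%:R^-1.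
  rewrite /Rintegral integral_indic// setIT.
  exact: (congr1 fine (unif kT)).
have inner w : \int[P]_s h (w, tau s) = T%:R^-1 * phi k w.
  under eq_Rintegral do rewrite E.
  by rewrite (RintegralZl _ measurableT intA) PA mulrC.
under eq_Rintegral do rewrite inner.
by rewrite RintegralZl//; exact: iphi.
Qed.

Lemma uniform_sampling :
  (\int[P]_w (phi (tau w) w)%:E = (T%:R^-1 * \sum_(k < T) \int[P]_w phi k w)%:E)%E.
Proof.
have mq : measurable_fun setT (fun w => phi (tau w) w).
  move=> _ B mB; rewrite setTI.
  rewrite (_ : _ @^-1` _ = \bigcup_k (A k `&` phi k @^-1` B)); last first.
    apply/seteqP; split => w /=; first by move=> h; exists (tau w).
    by move=> [k _ [/= <-]].
  apply: bigcupT_measurable => k; apply: measurableI => //.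
  by rewrite -[X in measurable X]setTI; exact: mphiO.
pose g w := \sum_(k < T) phi k w * \1_(A k) w.
have ig : P.-integrable setT (fun w => (g w)%:E).
  by apply: integrable_sumR => k; have [] := sampled (ltn_ord k).
have gE : \int[P]_w g w = T%:R^-1 * \sum_(k < T) \int[P]_w phi k w.
  rewrite Rintegral_sum; last by move=> k; have [] := sampled (ltn_ord k).
  by rewrite mulr_sumr; apply: eq_bigr => k _; have [] := sampled (ltn_ord k).
rewrite -gE /Rintegral fineK; last exact: integrable_fin_num.
apply: ge0_ae_eq_integral => //.
- exact/measurable_EFinP.
- by have /integrableP[] := ig.
- by move=> w _; rewrite lee_fin.
- by move=> w _; rewrite lee_fin sumr_ge0// => k _; rewrite mulr_ge0.
(* The [T] events of probability [1 / T] already have total mass 1, so [tau < T] almost surely and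
   the values of [phi] beyond [T] do not matter. *)
have mU : measurable (\big[setU/set0]_(k < T) A k) by exact: bigsetU_measurable.
have PU : P (\big[setU/set0]_(k < T) A k) = 1%E.
  rewrite measure_semi_additive_ord_I//; last first.
    by move=> i j _ _ [w [/= <- <-]].
  rewrite (eq_bigr (fun=> (T%:R^-1)%:E)); last by move=> k _; exact: unif.
  rewrite sumEFin sumr_const card_ord -[X in X%:E]mulr_natr mulVf//.
  by rewrite pnatr_eq0 -lt0n.
exists (~` (\big[setU/set0]_(k < T) A k)); split.
- exact: measurableC.
- by rewrite [LHS]probability_setC// PU subee.
move=> w /= nw Uw; apply: nw => _; congr EFin.
have tT : (tau w < T)%N.
  by move: Uw; rewrite -bigcup_mkord => -[k /= kT]; rewrite /A /preimage /= => ->.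
rewrite /g (bigD1 (Ordinal tT))//= indicE mem_set// mulr1 big1 ?addr0// => k kt.
rewrite indicE memNset ?mulr0//= => e; move/eqP: kt; apply.
by apply: val_inj; rewrite /= e.
Qed.

End uniform_sampling.

(** * The convergence rate *)

Lemma inf_range_le (R : realType) (X : Type) (g : X -> R) (c : R) (y : X) :
  (forall z, c <= g z) -> inf (range g) <= g y.
Proof.
move=> gc; apply: ge_inf; last by exists y.
by exists c => _ [z _ <-].
Qed.



Theorem theorem7 (R : realType) :
  exists C : R -> R -> R -> R,
  forall (d : nat) (f : 'rV[R]_d -> R) (L0 fstar eps : R) (T : nat)
    (eta delta : R) (x0 : 'rV[R]_d)
    (* the space carrying the perturbations and the random index *)
    (dO : measure_display) (Omega : measurableType dO)
    (P : probability Omega R)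
    (u x : nat -> Omega -> 'rV[R]_d) (tau : {RV P >-> nat})
    (* a standard Gaussian vector v, on any space, defining f_delta *)
    (dS : measure_display) (S : measurableType dS)
    (Q : probability S R) (v : S -> 'rV[R]_d),
  (0 < d)%N ->
  0 < L0 ->
  (forall y z, `|f y - f z| <= L0 * enorm (y - z)) ->
  (forall y, fstar <= f y) ->
  0 < eps ->
  1 / eps < T%:R ->
  eta = Num.sqrt eps / (2 * d%:R * L0 ^+ 2 * Num.sqrt T%:R) ->
  delta = eps / (L0 * Num.sqrt d%:R) ->
  iid_standard_gaussian P u ->
  (forall w, x 0%N w = x0) ->
  (forall t w, x t.+1 w =
     x t w - eta *: residual_feedback f delta (u ^~ w) (x ^~ w) t) ->
  uniform_index T tau ->
  independent P (g_sigma_algebra_preimage tau) (sigma_process u) ->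
  standard_gaussian Q v ->
  let fdelta := smoothed Q v f delta in
  let gap := fdelta x0 - inf (range fdelta) in
  let G0 := fine ('E_P[(fun w =>
    enorm (residual_feedback f delta (u ^~ w) (x ^~ w) 0) ^+ 2)%R])%E in
  ('E_P[(fun w => enorm (grad fdelta (x (tau w) w)) ^+ 2)%R] <=
    (C L0 gap G0 * d%:R ^+ 2 * eps `^ (- (1 / 2)) * T%:R `^ (- (1 / 2)))%R%:E)%E.
Proof.
pose K := @taylor_const R; pose M := @normal_moment4 R.
(* The three terms come from [gap / (eta T)], from the initial second moment, and from the fourth
   moments of the perturbations. *)
exists (fun L0 gap G0 => 2 * L0 ^+ 2 * gap + (K + 1) * G0 + 8 * (K + 1) * M * L0 ^+ 2).
move=> d f L0 fstar eps T eta delta x0 dO Omega P u x tau dS S Q v.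
move=> d0 L00 fL fge eps0 epsT etaE deltaE uG xx0 xS unif ind gv; cbv zeta.
set fdelta := smoothed Q v f delta; set gap := fdelta x0 - _; set G0 := fine _.
have K1 : 1 <= K := taylor_const_ge1.
have M0 : 0 <= M := normal_moment4_ge0.
have T0 : 0 < T%:R :> R by rewrite (lt_trans _ epsT)// divr_gt0.
have T0n : (0 < T)%N by rewrite -(ltr0n R).
have dR1 : 1 <= d%:R :> R by rewrite ler1n.
have TR1 : 1 <= T%:R :> R by rewrite ler1n.
pose se := Num.sqrt eps; pose sd := Num.sqrt (d%:R : R); pose sT := Num.sqrt (T%:R : R).
have se0 : 0 < se by rewrite sqrtr_gt0.
have sd0 : 0 < sd by rewrite sqrtr_gt0; lra.
have sT0 : 0 < sT by rewrite sqrtr_gt0.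
have eE : eps = se ^+ 2 by rewrite sqr_sqrtr// ltW.
have dE : d%:R = sd ^+ 2 by rewrite sqr_sqrtr// ler0n.
have TE : T%:R = sT ^+ 2 by rewrite sqr_sqrtr// ler0n.
have delta0 : 0 < delta.
  by rewrite deltaE divr_gt0// mulr_gt0.
have eta0 : 0 < eta.
  have dR0 : 0 < d%:R :> R by lra.
  by rewrite etaE divr_gt0 ?mulr_gt0 ?exprn_gt0.
have deltaE' : delta = se ^+ 2 / (L0 * sd) by rewrite deltaE eE.
have etaE' : eta = se / (2 * sd ^+ 2 * L0 ^+ 2 * sT) by rewrite etaE dE.
have nz : [/\ se != 0, sd != 0, sT != 0 & L0 != 0].
  by split; rewrite gt_eqF.
have [nse nsd nsT nL] := nz.
have al : 2 * (L0 * eta / delta) ^+ 2 * d%:R <= 1 / 2.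
  rewrite (_ : _ * d%:R = (eps * T%:R)^-1 / 2); last first.
    by rewrite deltaE' etaE' eE TE dE; field; rewrite nse nsd nsT nL.
  rewrite ler_pM2r ?invr_gt0// invf_le1 ?mulr_gt0//.
  by move: epsT; rewrite ltr_pdivrMr// mulrC => /ltW.
(* The lower bound of [f] passes to [fdelta], so the infimum is a genuine one and not the default
   value of [inf]. *)
have fdge y : inf (range fdelta) <= fdelta y.
  by apply: (@inf_range_le _ _ _ fstar) => z; exact: (smoothed_ge gv delta0 fL z fge).
have G0E : G0 = second_moment f delta P u x 0.
  rewrite /G0 unlock; congr fine; apply: eq_integral => w _.
  by rewrite residual_feedbackE.
pose C := \bigcup_t sigma_vector (u t).
have Cm : <<s C >> `<=` measurable.
  apply: smallest_sub; first exact: sigma_algebra_measurable.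
  move=> A [t _]; apply: sigma_vector_measurable.
  by have [h _ _] := uG.1 t; exact: h.
have mphi k : measurable_fun setT
    ((fun w => enorm (sgrad Q v f delta (x k w)) ^+ 2) : g_sigma_algebraType C -> R).
  under eq_fun do rewrite sqr_enorm.
  apply: measurable_sum => i; apply: measurable_funX.
  have mi : measurable_fun setT (id : g_sigma_algebraType C -> g_sigma_algebraType (past u k)).
    move=> _ A mA; rewrite setTI; apply: sub_sigma_algebra2 mA => B [s _ sB].
    by exists s.
  exact: (measurableT_comp (measurable_sgrad_iterate L00 delta0 fL xx0 xS gv i) mi).
have iphi := integrable_sqr_sgrad L00 delta0 fL uG xx0 xS gv.
rewrite unlock.
under eq_integral do rewrite (grad_smoothed gv L00 delta0 fL).
rewrite (uniform_sampling Cm T0n unif ind mphi (fun _ _ => sqr_ge0 _) iphi).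
rewrite lee_fin.
have := sum_sqr_sgrad_mean_le d0 L00 delta0 (ltW eta0) fL uG xx0 xS gv T al fdge.
rewrite -/gap -G0E -/K -/M.
set X := \sum_(t < T) _ => hX.
have -> : eps `^ (- (1 / 2)) = se^-1 by rewrite powRN div1r powR12_sqrt// ltW.
have -> : T%:R `^ (- (1 / 2)) = sT^-1 by rewrite powRN div1r powR12_sqrt// ler0n.
have -> : T%:R^-1 * (\sum_(k < T) \int[P]_w (enorm (sgrad Q v f delta (x k w)) ^+ 2))
    = eta * X / (eta * T%:R).
  by rewrite -/X; field; rewrite !gt_eqF.
have eT0 : 0 < eta * T%:R by rewrite mulr_gt0.
rewrite ler_pdivrMr//; apply: (le_trans hX).
rewrite -ler_pdivrMr//.
(* In square roots of [eps], [d] and [T] everything is rational, and [L0 / delta * sd * eta] equals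
   [(2 * se * sT)^-1]. *)
rewrite (_ : _ / (eta * T%:R) = (se * sT)^-1 *
    (2 * d%:R * L0 ^+ 2 * gap + (K + 1) * (G0 / T%:R + 8 * L0 ^+ 2 * M * d%:R ^+ 2))); last first.
  by rewrite -/sd deltaE' etaE' TE dE; field; rewrite nse nsd nsT nL.
rewrite (_ : _ * d%:R ^+ 2 / se / sT = (se * sT)^-1 *
    ((2 * L0 ^+ 2 * gap + (K + 1) * G0 + 8 * (K + 1) * M * L0 ^+ 2) * d%:R ^+ 2)); last first.
  by field; rewrite nse nsT.
rewrite ler_pM2l ?invr_gt0 ?mulr_gt0//.
have gap0 : 0 <= gap by rewrite subr_ge0.
have G00 : 0 <= G0 by rewrite G0E; exact: second_moment_ge0.
have d2 : 1 <= d%:R ^+ 2 :> R by rewrite exprn_ege1.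
have dd2 : d%:R <= d%:R ^+ 2 :> R by rewrite expr2 ler_peMl//; lra.
(* Only the fourth-moment term is truly of order [d^2]; the gap term, of order [d], and the term
   [G0 / T] are enlarged to it. *)
have h1 : d%:R * (2 * L0 ^+ 2 * gap) <= d%:R ^+ 2 * (2 * L0 ^+ 2 * gap).
  have L2 := sqr_ge0 L0.
  have g2 : 0 <= 2 * L0 ^+ 2 * gap by apply: mulr_ge0 => //; lra.
  exact: (ler_wpM2r g2 dd2).
have h2 : (K + 1) * (G0 / T%:R) <= (K + 1) * G0 * d%:R ^+ 2.
  rewrite -mulrA ler_wpM2l//; first lra.
  rewrite (@le_trans _ _ G0)//; first by rewrite ler_pdivrMr// ler_peMr.
  by rewrite ler_peMr.
lra.
Qed.
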